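(* Let $n\geq 1$ be an integer. (1) Every embedding of $\mathbb{C}\times\mathbb{C}\times\mathbb{C}$ into $\mathbb{S}^n$ is congruent to $$A^{(1)}_{k_1,k_2,k_3}:=\operatorname{Diag}(x{\bf 1}_{k_1+k_2+k_3},\,y{\bf 1}_{k_2+k_3},\,z{\bf 1}_{k_3})$$ for some integers $k_1,k_2\geq0$ and $k_3\geq1$ with $k_1+2k_2+3k_3=n$. (2) Every embedding of $\mathbb{C}\times\mathcal{J}^1_0$ into $\mathbb{S}^n$ is congruent to $$A^{(2)}_{r,k_1,k_2}:=\operatorname{Diag}\left(x{\bf 1}_r,\;{\bf 1}_{k_2}\otimes\begin{pmatrix}z&y\\ y&0\end{pmatrix},\;y{\bf 1}_{k_1}\right)$$ for some integers $r,k_2\geq1$ and $k_1\geq0$ with $k_1+2k_2=n-r$. (3) Every embedding of $\mathbb{C}[x]/(x^3)$ into $\mathbb{S}^n$ is congruent to $$A^{(3)}_{k_1,k_2,k_3}:=\operatorname{Diag}\left({\bf 1}_{k_3}\otimes\begin{pmatrix}z&y&x\\ y&x&0\\ x&0&0\end{pmatrix},\;{\bf 1}_{k_2}\otimes\begin{pmatrix}y&x\\ x&0\end{pmatrix},\;x{\bf 1}_{k_1}\right)$$ for some integers $k_1,k_2\geq0$ and $k_3\geq1$ with $k_1+2k_2+3k_3=n$. (4) The Jordan algebra $\mathcal{J}^2_2$ has no embeddings into $\mathbb{S}^n$ when $n$ is odd. When $n$ is even, every embedding of $\mathcal{J}^2_2$ into $\mathbb{S}^n$ is congruent to $B^{(1)}_{n/2}:=\mathbb{S}^2\otimes{\bf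 1}_{n/2}$. (5) Every embedding of $\mathcal{J}^2_1$ into $\mathbb{S}^n$ is congruent to $$B^{(2)}_{k,\ell_1,\ell_2}:=\operatorname{Diag}\left(\begin{pmatrix}x{\bf J}_{\ell_2}&z\operatorname{Diag}({\bf 1}_k,{\bf 0}_{\ell_2-k})\\ z\operatorname{Diag}({\bf 1}_k,{\bf 0}_{\ell_2-k})&y{\bf J}_{\ell_2}\end{pmatrix},\;y{\bf 1}_{\ell_1}\right)$$ for some integers $\ell_1\geq0$, $\ell_2\geq2$ and $1\leq k\leq \ell_2/2$ such that $\ell_1+2\ell_2=n$.
   Context: $\mathbb{S}^n$ is the space of complex symmetric $n\times n$ matrices. A (unital) Jordan algebra is a complex vector space with a symmetric bilinear product satisfying $(x\cdot x)\cdot(x\cdot y)=x\cdot((x\cdot x)\cdot y)$ for all $x,y$ and having a unit; morphisms are linear maps preserving products and units. For an invertible $U\in\mathbb{S}^n$, the product $X\bullet_U Y=\frac12(XU^{-1}Y+YU^{-1}X)$ makes $\mathbb{S}^n$ a unital Jordan algebra with unit $U$. An embedding of a Jordan algebra $\mathcal{A}$ into $\mathbb{S}^n$ is the image of an injective morphism of unital Jordan algebras $\mathcal{A}\to(\mathbb{S}^n,\bullet_U)$ for some invertible $U\in\mathbb{S}^n$. Two subspaces $\mathcal{L},\mathcal{L}'\subseteq\mathbb{S}^n$ are congruent if $\mathcal{L}'=P\mathcal{L}P^\top$ for some $P\in\mathrm{GL}_n(\mathbb{C})$. For integers $d\ge1$, $0\le r\le d$, $\mathcal{J}^d_r$ is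 the Jordan algebra $\mathbb{C}\times\mathbb{C}^d$ with product $(\lambda,v)\cdot(\mu,w)=(\lambda\mu+\beta(v,w),\lambda w+\mu v)$, where $\beta(v,w)=v_1w_1+\dots+v_rw_r$. Products of Jordan algebras carry the componentwise product; $\mathbb{C}$ and $\mathbb{C}[x]/(x^3)$ carry their usual commutative product. A matrix whose entries are linear forms in indeterminates $x,y,z$ denotes the linear space of all matrices obtained by substituting complex numbers for the indeterminates. ${\bf 1}_k$ and ${\bf 0}_k$ are the $k\times k$ identity and zero matrices, ${\bf J}_k$ is the $k\times k$ matrix with $1$'s on the anti-diagonal and $0$'s elsewhere, $\operatorname{Diag}(\dots)$ is the block-diagonal matrix with the given blocks (blocks of size $0$ are omitted), and $X\otimes Y$ is the Kronecker product, the block matrix with blocks $X_{ij}Y$. Thus ${\bf 1}_k\otimes M=\operatorname{Diag}(M,\dots,M)$ and $\mathbb{S}^2\otimes{\bf 1}_m=\left\{\begin{pmatrix}x{\bf 1}_m&z{\bf 1}_m\\ z{\bf 1}_m&y{\bf 1}_m\end{pmatrix}\right\}$. *)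

(* Defs.v *)
From HB Require Import structures.
From mathcomp Require Import all_boot all_order all_algebra.
From mathcomp Require Import qpoly.
From mathcomp Require Import mxtens complex.
From mathcomp Require Import boolp classical_sets reals.
From mathcomp Require Import ring.

Set Implicit Arguments.
Unset Strict Implicit.
Unset Printing Implicit Defensive.

Import Order.TTheory GRing.Theory Num.Theory.
Local Open Scope ring_scope.
Local Open Scope classical_set_scope.

(* Linearity in the first argument and commutativity give bilinearity. *)
Record jordanAlgebra (K : fieldType) := JordanAlgebra {
  jcarrier :> lmodType K;
  jmul : jcarrier -> jcarrier -> jcarrier;
  jone : jcarrier;
  jmulC : commutative jmul;
  jmul_linear : forall y, linear (jmul^~ y);
  jmul_jordan : forall x y,
    jmul (jmul x x) (jmul x y) = jmul x (jmul (jmul x x) y);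
  jmul1 : left_id jone jmul }.

Definition jordan_morphism (K : fieldType) (A B : jordanAlgebra K)
    (f : A -> B) : Prop :=
  [/\ linear f,
      forall x y, f (jmul x y) = jmul (f x) (f y) &
      f (jone A) = jone B].

Section CommutativeAlgebra.
Context (K : fieldType) (A : comAlgType K).

Let cmul_linear (y : A) : linear (fun x : A => x * y).
Proof. by move=> a u v; rewrite mulrDl scalerAl. Qed.

Let cmul_jordan (x y : A) : x * x * (x * y) = x * (x * x * y).
Proof. by rewrite !mulrA. Qed.

Definition comJordan : jordanAlgebra K :=
  @JordanAlgebra K A (fun x y => x * y) 1 (@mulrC A)
    cmul_linear cmul_jordan (@mul1r A).
End CommutativeAlgebra.

Definition truncated_poly (K : fieldType) : comAlgType K := {poly %/ 'X^3}.

(* [{poly %/ h}] is the quotient by [mk_monic h]. *)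
Fact mk_monicX3 (K : fieldType) : mk_monic ('X^3 : {poly K}) = 'X^3.
Proof. by rewrite /mk_monic size_polyXn monicXn. Qed.

Section Product.
Context (K : fieldType) (A B : jordanAlgebra K).

Definition prod_jmul (x y : A * B) : A * B := (jmul x.1 y.1, jmul x.2 y.2).

Let prod_jmulC : commutative prod_jmul.
Proof. by move=> x y; congr pair; apply: jmulC. Qed.

Let prod_jmul_linear (y : A * B) : linear (prod_jmul^~ y).
Proof. by move=> a u v; congr pair; apply: jmul_linear. Qed.

Let prod_jmul_jordan (x y : A * B) :
  prod_jmul (prod_jmul x x) (prod_jmul x y)
  = prod_jmul x (prod_jmul (prod_jmul x x) y).
Proof. by congr pair; apply: jmul_jordan. Qed.

Let prod_jmul1 : left_id (jone A, jone B) prod_jmul.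
Proof. by case=> x y; congr pair; apply: jmul1. Qed.

Definition prodJordan : jordanAlgebra K :=
  @JordanAlgebra K (A * B)%type prod_jmul (jone A, jone B)
    prod_jmulC prod_jmul_linear prod_jmul_jordan prod_jmul1.
End Product.

Section SpinFactor.
Context (K : fieldType) (d r : nat).

Definition spin_form (v w : 'rV[K]_d) : K :=
  \sum_(i < d | (i < r)%N) v 0 i * w 0 i.

Definition spin_mul (x y : K^o * 'rV[K]_d) : K^o * 'rV[K]_d :=
  (x.1 * y.1 + spin_form x.2 y.2, x.1 *: y.2 + y.1 *: x.2).

Let spin_formC (v w : 'rV[K]_d) : spin_form v w = spin_form w v.
Proof. by apply: eq_bigr => i _; rewrite mulrC. Qed.

Let spin_formDZl a (u v w : 'rV[K]_d) :
  spin_form (a *: u + v) w = a * spin_form u w + spin_form v w.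
Proof.
rewrite /spin_form mulr_sumr -big_split /=.
by apply: eq_bigr => i _; rewrite !mxE mulrDl mulrA.
Qed.

Let spin_mulC : commutative spin_mul.
Proof.
by move=> x y; rewrite /spin_mul mulrC spin_formC [in X in (_, X)]addrC.
Qed.

Let spin_mul_linear (y : K^o * 'rV[K]_d) : linear (spin_mul^~ y).
Proof.
case: y => [c w] a [b u] [b' v]; congr pair => /=.
  rewrite spin_formDZl.
  have E (k p q m s t : K) :
      (k * p + q) * m + (k * s + t) = k * (p * m + s) + (q * m + t) by ring.
  exact: E.
apply/rowP => i; rewrite !mxE.
have E (k p q m s t h : K) :
    (k * p + q) * h + m * (k * s + t) = k * (p * h + m * s) + (q * h + m * t).
  by ring.
exact: E.
Qed.

Let spin_mul_jordan (x y : K^o * 'rV[K]_d) :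
  spin_mul (spin_mul x x) (spin_mul x y)
  = spin_mul x (spin_mul (spin_mul x x) y).
Proof.
have fZ (c : K) u t : spin_form (c *: u) t = c * spin_form u t.
  rewrite /spin_form mulr_sumr.
  by apply: eq_bigr => i _; rewrite mxE mulrA.
have fD u1 u2 t : spin_form (u1 + u2) t = spin_form u1 t + spin_form u2 t.
  by rewrite -[u1]scale1r spin_formDZl mul1r scale1r.
have fZr (c : K) u t : spin_form t (c *: u) = c * spin_form t u.
  by rewrite ![spin_form t _]spin_formC fZ.
have fDr u1 u2 t : spin_form t (u1 + u2) = spin_form t u1 + spin_form t u2.
  by rewrite ![spin_form t _]spin_formC fD.
case: x y => [a v] [b w]; congr pair => /=.
  rewrite !(fD, fDr, fZ, fZr).
  have E (k l p q : K) :
      (k * k + p) * (k * l + q) +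
        (k * (k * q) + k * (l * p) + (k * (k * q) + k * (l * p))) =
      k * ((k * k + p) * l + (k * q + k * q)) +
        ((k * k + p) * q + l * (k * p + k * p)) by ring.
  exact: E.
apply/rowP => i; rewrite !mxE fD fZ.
have E (k l p q s t : K) :
    (k * k + p) * (k * s + l * t) + (k * l + q) * (k * t + k * t) =
    k * ((k * k + p) * s + l * (k * t + k * t)) +
      ((k * k + p) * l + (k * q + k * q)) * t by ring.
exact: E.
Qed.

Let spin_mul1 : left_id ((1, 0) : K^o * 'rV[K]_d) spin_mul.
Proof.
case=> b w; congr pair => /=; last by rewrite scaler0 addr0 scale1r.
by rewrite mul1r /spin_form big1 ?addr0 // => i _; rewrite mxE mul0r.
Qed.

Definition spinJordan : jordanAlgebra K :=
  @JordanAlgebra K (K^o * 'rV[K]_d)%type spin_mul (1, 0)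
    spin_mulC spin_mul_linear spin_mul_jordan spin_mul1.
End SpinFactor.

Definition symmx_pred (K : fieldType) (n : nat) : {pred 'M[K]_n} :=
  fun X => X^T == X.

Fact symmx_submod_closed (K : fieldType) (n : nat) :
  submod_closed (@symmx_pred K n).
Proof.
split=> [|a X Y]; first by rewrite unfold_in trmx0.
by rewrite !unfold_in linearP /= => /eqP -> /eqP ->.
Qed.

HB.instance Definition _ (K : fieldType) (n : nat) :=
  GRing.isSubmodClosed.Build K 'M[K]_n (@symmx_pred K n)
    (@symmx_submod_closed K n).

Record symmx (K : fieldType) (n : nat) := SymMx {
  symval :> 'M[K]_n;
  symvalP : symval \in @symmx_pred K n }.

HB.instance Definition _ (K : fieldType) (n : nat) :=
  [isSub for @symval K n].
HB.instance Definition _ (K : fieldType) (n : nat) :=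
  [Choice of symmx K n by <:].
HB.instance Definition _ (K : fieldType) (n : nat) :=
  [SubChoice_isSubLmodule of symmx K n by <:].

Section SymJordan.
Context (K : numFieldType) (n : nat) (U : symmx K n).

Definition bullet_mx (X Y : 'M[K]_n) : 'M[K]_n :=
  2%:R^-1 *: (X *m invmx U *m Y + Y *m invmx U *m X).

Fact bullet_mx_sym (X Y : symmx K n) : bullet_mx X Y \in @symmx_pred K n.
Proof.
move: (symvalP X) (symvalP Y) (symvalP U).
rewrite !unfold_in /bullet_mx => /eqP sX /eqP sY /eqP sU.
rewrite linearZ linearD /= !trmx_mul trmx_inv sX sY sU !mulmxA.
by rewrite [X in _ *: X]addrC.
Qed.

Definition bullet (X Y : symmx K n) : symmx K n := SymMx (bullet_mx_sym X Y).

Let bulletC : commutative bullet.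
Proof. by move=> X Y; apply: val_inj; rewrite /= /bullet_mx addrC. Qed.

Let bullet_linear (Y : symmx K n) : linear (bullet^~ Y).
Proof.
move=> a X Z; apply: val_inj; rewrite /= /bullet_mx /=.
rewrite !mulmxDl !mulmxDr -!scalemxAl -!scalemxAr addrACA.
by rewrite scalerDr -[X in _ *: X + _]scalerDr !scalerA mulrC.
Qed.

Let bullet_mx_sqr (X : 'M[K]_n) : bullet_mx X X = X *m invmx U *m X.
Proof. by rewrite /bullet_mx -mulr2n -scaler_nat scalerA mulVf ?scale1r ?pnatr_eq0. Qed.

Let bullet_jordan (X Y : symmx K n) :
  bullet (bullet X X) (bullet X Y) = bullet X (bullet (bullet X X) Y).
Proof.
apply: val_inj; rewrite /= bullet_mx_sqr /bullet_mx.
rewrite -!scalemxAl -!scalemxAr -!scalerDr; congr (_ *: (_ *: _)).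
by rewrite !(mulmxDl, mulmxDr, mulmxA) addrACA.
Qed.

Context (Uunit : (U : 'M[K]_n) \in unitmx).

Let bullet1 : left_id U bullet.
Proof.
move=> X; apply: val_inj; rewrite /= /bullet_mx mulmxV // mul1mx mulmxKV //.
by rewrite -mulr2n -scaler_nat scalerA mulVf ?scale1r ?pnatr_eq0.
Qed.

Definition symJordan : jordanAlgebra K :=
  @JordanAlgebra K (symmx K n) bullet U bulletC bullet_linear bullet_jordan
    bullet1.
End SymJordan.

(* Linear spaces of symmetric matrices are represented by their underlying sets
   of matrices, so an embedding, being an image, is a set. *)
Definition is_embedding (K : numFieldType) (A : jordanAlgebra K) (n : nat)
    (L : set 'M[K]_n) : Prop :=
  exists (U : symmx K n) (Uunit : (U : 'M[K]_n) \in unitmx)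
         (f : A -> symJordan Uunit),
    [/\ jordan_morphism f, injective f & L = range (fun a => symval (f a))].

(* The equation [e] transports L' to size n, so that block matrices may be
   given in whatever form their size naturally has. *)
Definition congruent (K : fieldType) (n m : nat) (e : m = n)
    (L : set 'M[K]_n) (L' : set 'M[K]_m) : Prop :=
  exists2 P : 'M[K]_n, P \in unitmx &
    [set castmx (e, e) X | X in L'] = [set P *m X *m P^T | X in L].

Definition Diag (K : fieldType) (m n : nat) (A : 'M[K]_m) (B : 'M[K]_n) :
  'M[K]_(m + n) := block_mx A 0 0 B.

Definition rows_mx (K : fieldType) (n : nat) (s : seq (seq K)) : 'M[K]_n :=
  \matrix_(i < n, j < n) nth 0 (nth [::] s i) j.

Definition antidiag_mx (K : fieldType) (n : nat) : 'M[K]_n :=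
  \matrix_(i < n, j < n) ((i + j).+1 == n)%:R.

Unset Implicit Arguments.

Definition A1 {K : fieldType} (k1 k2 k3 : nat) :
    set 'M[K]_((k1 + k2 + k3) + ((k2 + k3) + k3)) :=
  [set M | exists x y z : K, M = Diag x%:M (Diag y%:M z%:M)].

Definition A2 {K : fieldType} (r k1 k2 : nat) :
    set 'M[K]_(r + (k2 * 2 + k1)) :=
  [set M | exists x y z : K,
    M = Diag x%:M
          (Diag (tensmx 1%:M (rows_mx 2 [:: [:: z; y];
                                            [:: y; 0]]))
                y%:M)].

Definition A3 {K : fieldType} (k1 k2 k3 : nat) :
    set 'M[K]_(k3 * 3 + (k2 * 2 + k1)) :=
  [set M | exists x y z : K,
    M = Diag (tensmx 1%:M (rows_mx 3 [:: [:: z; y; x];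
                                         [:: y; x; 0];
                                         [:: x; 0; 0]]))
          (Diag (tensmx 1%:M (rows_mx 2 [:: [:: y; x];
                                            [:: x; 0]]))
                x%:M)].

Definition B1 {K : fieldType} (m : nat) : set 'M[K]_(2 * m) :=
  range (fun S : symmx K 2 => tensmx (symval S) 1%:M).

(* For k <= l2, [pid_mx k : 'M_l2] is Diag(1_k, 0_{l2-k}). *)
Definition B2 {K : fieldType} (k l1 l2 : nat) : set 'M[K]_(l2 + l2 + l1) :=
  [set M | exists x y z : K,
    M = Diag (block_mx (x *: antidiag_mx K l2) (z *: pid_mx k)
                       (z *: pid_mx k) (y *: antidiag_mx K l2))
             y%:M].

(* Main.v *)
Require Import Defs.
From mathcomp Require Import all_boot all_order all_algebra.
From mathcomp Require Import qpoly mxtens complex boolp classical_sets reals.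
From mathcomp Require Import zify ring.

(**
Write the unit U of the Jordan product as G G^T.  Then X |-> G^-1 X G^-T turns
the product X U^-1 Y + Y U^-1 X into X Y + Y X, so an embedding becomes a linear
injective family of symmetric matrices g(a), with g(1) = 1, on the space C^n
with its standard bilinear form (embedding_symmetric_rep).  Each of the five
algebras has a basis of three elements, and the task is to find, for the three
matrices which represent it, a common normal form under X |-> Q X Q^T.  The
matrix Q need not be orthogonal: Q Q^T is the value of Q 1 Q^T, and it is the
image of the unit of the algebra.

Over an algebraically closed field a symmetric matrix S of rank r satisfies
V S V^T = 1 for some r x n matrix V (symm_gram_identity), and a system of vectors
with invertible Gram matrix has an orthonormal complement
(orthonormal_complement).  Everything else rests on these two facts.

- A symmetric idempotent is the orthogonal projection onto the span of an
  orthonormal system, so orthogonal idempotents decompose C^n orthogonally.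
  This settles C x C x C (three_idempotents_congruent), the three ranks being
  sorted, and splits off the first factor of C x J^1_0.

- A symmetric N with N^(d+1) = 0 has an analogue of the Jordan form.  The
  symmetric form u N^d v^T has rank a = rank N^d.  One can choose a vectors v_i,
  orthonormal for it, such that the chains v_i, v_i N, ..., v_i N^d pair to 1
  exactly when the exponents add up to d (nilpotent_chain_gram).  The Gram
  matrices of 1, N, N^2, ... on these chains are the Hankel blocks of the
  statement, and on the orthogonal complement of the chains N^d vanishes
  (nilpotent_split).  Applied with d = 1 this finishes C x J^1_0; applied with
  d = 2 and then d = 1 it gives C[x]/(x^3).

- In J^2_r, with r = 1, 2, the idempotent E = (1 + v_1)/2 splits C^n as a sum of
  spaces of dimensions p and q which are exchanged by Z = v_2: in adapted
  orthonormal bases Z is a block matrix with zero diagonal blocks and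
  off-diagonal blocks A and A^T (spin_frames).  Now Z^2 = c says
  A A^T = c and A^T A = c.  If c = 1 then A is orthogonal, so p = q, and changing
  the second basis by A turns A into 1.  If c = 0 then A = B^T D with both B and D
  having independent isotropic rows, and the extension theorem of Witt
  (witt_isotropic_form) moves the rows of B and D to coordinate vectors in bases
  where the form is antidiagonal (isotropic_pair_normal_form).
*)

Set Implicit Arguments.
Unset Strict Implicit.
Unset Printing Implicit Defensive.

Import Order.TTheory GRing.Theory Num.Theory.
Local Open Scope ring_scope.

(** * Symmetric bilinear forms and orthonormal systems *)

(** Polarization: a symmetric form which vanishes on the diagonal vanishes; any
non-zero value is then scaled to 1 by a square root. *)
Lemma symm_nonisotropic (C : numClosedFieldType) n (S : 'M[C]_n) :
  S^T = S -> S != 0 -> exists u : 'rV_n, u *m S *m u^T = 1.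
Proof.
move=> sS S0; have [//|noU] := boolp.EM (exists u : 'rV_n, u *m S *m u^T = 1).
case/eqP: S0; have q0 (u : 'rV_n) : u *m S *m u^T = 0.
  apply/eqP; apply: contra_notT noU => nz.
  have [c Ec] : exists c, u *m S *m u^T = c%:M.
    by exists ((u *m S *m u^T) 0 0); apply: mx11_scalar.
  have c0 : c != 0 by apply: contra nz => /eqP c0; rewrite Ec c0 raddf0.
  exists ((sqrtC c)^-1 *: u).
  rewrite linearZ -!scalemxAl -scalemxAr scalerA Ec scale_scalar_mx.
  by rewrite -invfM -expr2 sqrtCK mulVf.
apply/matrixP => i j; rewrite mxE.
have := q0 (delta_mx 0 i + delta_mx 0 j).
have := q0 (delta_mx 0 j); have := q0 (delta_mx 0 i).
rewrite linearD /= !(mulmxDl, mulmxDr) => -> ->; rewrite add0r addr0.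
move/matrixP/(_ 0 0); rewrite mxE.
have E a b : ((delta_mx 0 a : 'rV_n) *m S *m (delta_mx 0 b : 'rV_n)^T) 0 0 = S a b.
  by rewrite -rowE trmx_delta -colE !mxE.
rewrite !E mxE.
have -> : S j i = S i j by rewrite -{1}sS mxE.
by rewrite -mulr2n => /eqP; rewrite mulrn_eq0 => /eqP.
Qed.

(** Diagonalization of a possibly degenerate form, by induction on the rank: a
vector of norm 1 is split off, which lowers the rank by exactly one. *)
Lemma symm_gram_identity (C : numClosedFieldType) n (S : 'M[C]_n) :
  S^T = S -> exists V : 'M_(\rank S, n), V *m S *m V^T = 1%:M.
Proof.
have [r] := ubnP (\rank S); elim: r => // r IH in S * => rS sS.
have [->|S0] := eqVneq S 0.
  by rewrite mxrank0; exists 0; apply/matrixP => -[].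
have [u uSu] := symm_nonisotropic sS S0.
(* S' is the restriction of S to the complement of u, extended by 0 on u. *)
pose S' := S - S *m u^T *m (u *m S).
have sS' : S'^T = S'.
  by rewrite /S' linearB /= !trmx_mul trmxK sS.
have S'u : S' *m u^T = 0.
  by rewrite /S' mulmxBl -!mulmxA (mulmxA u) uSu mulmx1 subrr.
have S'1 : (S' <= S)%MS.
  apply/submxP; exists (1%:M - S *m u^T *m u).
  by rewrite /S' mulmxBl mul1mx !mulmxA.
have ltS : (\rank S' < \rank S)%N.
  apply: rank_ltmx; rewrite ltmxE S'1; apply/negP => /submxP[D ES].
  have := uSu; rewrite ES -!mulmxA S'u !mulmx0 => /matrixP/(_ 0 0) /eqP.
  by rewrite !mxE eq_sym oner_eq0.
have rS' : (\rank S).-1 = \rank S'.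
  apply/eqP; rewrite eqn_leq -[X in _ && X]ltnS prednK ?ltS ?andbT; last first.
    exact: leq_ltn_trans ltS.
  rewrite -subn1 leq_subLR.
  have -> : \rank S = \rank (S *m u^T *m (u *m S) + S')%R.
    by rewrite addrC subrK.
  apply: leq_trans (mxrank_add _ _) _; rewrite leq_add2r.
  by apply: leq_trans (mxrankM_maxr _ _) _; apply: rank_leq_row.
have [V' V'1] : exists V : 'M_((\rank S).-1, n), V *m S' *m V^T = 1%:M.
  by rewrite rS'; apply: IH => //; apply: leq_trans ltS _; rewrite -ltnS.
have : exists V : 'M_(1 + (\rank S).-1, n), V *m S *m V^T = 1%:M.
  pose V1 := V' - V' *m S *m u^T *m u.
  have V1u : V1 *m S *m u^T = 0.
    by rewrite /V1 !mulmxBl -!mulmxA (mulmxA u) uSu mulmx1 subrr.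
  have V1u' : u *m S *m V1^T = 0.
    by apply: trmx_inj; rewrite !trmx_mul trmxK sS mulmxA V1u trmx0.
  exists (col_mx u V1).
  rewrite mul_col_mx tr_col_mx mul_col_row uSu V1u' V1u.
  rewrite [X in block_mx _ _ _ X](_ : _ = 1%:M) ?scalar_mx_block //.
  rewrite -V'1 {2}/V1 linearB /= mulmxBr !trmx_mul !mulmxA V1u !mul0mx subr0.
  rewrite /S' !mulmxBl !mulmxBr !mulmxBl; congr (_ - _).
  by rewrite !mulmxA.
by rewrite add1n prednK ?lt0n ?mxrank_eq0.
Qed.

(** Congruence of an invertible symmetric matrix to the identity. *)
Lemma symm_gram_factor (C : numClosedFieldType) n (S : 'M[C]_n) :
  S^T = S -> S \in unitmx -> exists2 G : 'M_n, G \in unitmx & S = G *m G^T.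
Proof.
move=> sS uS; have := symm_gram_identity sS; rewrite mxrank_unit // => -[V VSV].
have uV : V \in unitmx by case/mulmx1_unit: (etrans (mulmxA _ _ _) VSV).
exists (invmx V); first by rewrite unitmx_inv.
have uVT : V^T \in unitmx by rewrite unitmx_tr.
by rewrite -[LHS](mulKmx uV) -[V *m S in LHS](mulmxK uVT) VSV mul1mx trmx_inv.
Qed.

(** How the independence of a system of vectors is always obtained below: from an
invertible Gram matrix. *)
Lemma gram_row_free (C : fieldType) m n p (H : 'M[C]_(m, n)) (X : 'M_(n, p))
    (Y : 'M_(p, m)) : H *m X *m Y \in unitmx -> row_free H.
Proof.
move=> u; rewrite -row_leq_rank; apply: leq_trans (mxrankM_maxl _ X).
by apply: leq_trans (mxrankM_maxl _ Y); rewrite mxrank_unit.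
Qed.

Lemma orthogonal_sym (K : fieldType) m n p (A : 'M[K]_(m, n)) (B : 'M_(p, n)) :
  A *m B^T = 0 -> B *m A^T = 0.
Proof. by move=> AB; apply: trmx_inj; rewrite trmx_mul trmxK AB trmx0. Qed.

(** The last clause says that W spans the whole orthogonal complement of H: the
projection W^T W is the identity there.  The complement is the image of
S = 1 - H^T (H H^T)^-1 H, and W is an orthonormal basis of it. *)
Lemma orthonormal_complement (C : numClosedFieldType) m n (H : 'M[C]_(m, n)) :
  H *m H^T \in unitmx ->
  exists p (W : 'M_(p, n)),
    [/\ (m + p = n)%N, W *m H^T = 0, W *m W^T = 1%:M &
       forall k (Y : 'M_(k, n)), Y *m H^T = 0 -> Y *m W^T *m W = Y].
Proof.
set G := H *m H^T => uG.
have sG : G^T = G by rewrite trmx_mul trmxK.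
pose S := 1%:M - H^T *m invmx G *m H.
have sS : S^T = S.
  by rewrite linearB /= !trmx_mul trmx_inv sG trmxK trmx1 mulmxA.
have SH : S *m H^T = 0.
  by rewrite mulmxBl mul1mx -!mulmxA -/G mulVmx // mulmx1 subrr.
have SS : S *m S = S.
  by rewrite {2}/S mulmxBr mulmx1 !mulmxA SH !mul0mx subr0.
have [V VSV] := symm_gram_identity sS.
pose W := V *m S.
have WH : W *m H^T = 0 by rewrite -mulmxA SH mulmx0.
have WW : W *m W^T = 1%:M by rewrite trmx_mul sS mulmxA -(mulmxA V) SS.
have [D SE] : exists D, S = D *m W.
  apply/submxP; rewrite -(geq_leqif (mxrank_leqif_sup _)) ?submxMl //.
  rewrite row_leq_rank.
  by apply: (@gram_row_free _ _ _ _ _ 1%:M W^T); rewrite mulmx1 WW unitmx1.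
exists (\rank S), W; split => //; last first.
  move=> k Y YH; have YS : Y = Y *m D *m W.
    by rewrite -mulmxA -SE mulmxBr mulmx1 !mulmxA YH !mul0mx subr0.
  by rewrite {1}YS -(mulmxA _ W) WW mulmx1 -YS.
apply/eqP; rewrite eqn_leq; apply/andP; split; last first.
  rewrite -{1}(mxrank1 C n) -[1%:M](subrK (H^T *m invmx G *m H)) -/S addnC.
  apply: leq_trans (mxrank_add _ _) _; rewrite leq_add2l.
  by apply: leq_trans (mxrankM_maxr _ _) _; apply: rank_leq_row.
suff: row_free (col_mx H W) by rewrite /row_free => /eqP <-; apply: rank_leq_col.
apply: (@gram_row_free _ _ _ _ _ 1%:M (col_mx H W)^T).
rewrite mulmx1 tr_col_mx mul_col_row -/G WH WW.
by rewrite (orthogonal_sym WH) unitmxE det_lblock det1 mulr1 -unitmxE.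
Qed.

(** A symmetric idempotent is an orthogonal projection: H consists of an
orthonormal basis of its image. *)
Lemma orthonormal_idempotent (C : numClosedFieldType) n (E : 'M[C]_n) :
  E^T = E -> E *m E = E ->
  exists r (H : 'M_(r, n)), H *m H^T = 1%:M /\ H^T *m H = E.
Proof.
move=> sE EE; have [V VEV] := symm_gram_identity sE.
pose H := V *m E; have HH : H *m H^T = 1%:M.
  by rewrite trmx_mul sE mulmxA -(mulmxA V) EE.
exists (\rank E), H; split=> //.
have HE : H *m E = H by rewrite -mulmxA EE.
have rE : (E <= H^T *m H)%MS.
  rewrite -(geq_leqif (mxrank_leqif_sup _)); last first.
    by rewrite /H mulmxA submxMl.
  apply: leq_trans (mxrankM_maxr H _); rewrite mulmxA HH mul1mx.
  by rewrite row_leq_rank (@gram_row_free _ _ _ _ _ 1%:M H^T) ?mulmx1 ?HH ?unitmx1.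
set P := H^T *m H in rE *.
have PP : P *m P = P by rewrite /P mulmxA -(mulmxA H^T) HH mulmx1.
have PE : P *m E = P by rewrite -mulmxA HE.
have sP : P^T = P by rewrite trmx_mul trmxK.
clearbody P; have [D ED] := submxP rE.
have EP : E *m P = E by rewrite ED -mulmxA PP.
by have := congr1 trmx EP; rewrite trmx_mul sP sE PE.
Qed.

(** Used to recover dimensions: an orthonormal system which is also complete has
as many vectors as the space has dimensions. *)
Lemma orthonormal_frame_size (K : fieldType) m n (Q : 'M[K]_(m, n)) :
  Q *m Q^T = 1%:M -> Q^T *m Q = 1%:M -> m = n.
Proof.
move=> Q1 Q2; apply/eqP; rewrite eqn_leq; apply/andP; split.
  have := mxrankM_maxl Q Q^T; rewrite Q1 mxrank1 => /leq_trans; apply.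
  exact: rank_leq_col.
have := mxrankM_maxl Q^T Q; rewrite Q2 mxrank1 => /leq_trans; apply.
exact: rank_leq_col.
Qed.

Lemma frame_gt0 (K : fieldType) r n (H : 'M[K]_(r, n)) :
  H^T *m H != 0 -> (0 < r)%N.
Proof. by case: r H => // H; rewrite (flatmx0 H) mulmx0 eqxx. Qed.

Lemma orthogonal_projections_frames (K : fieldType) n r s (H : 'M[K]_(r, n))
    (H' : 'M_(s, n)) :
  H *m H^T = 1%:M -> H' *m H'^T = 1%:M ->
  (H^T *m H) *m (H'^T *m H') = 0 -> H *m H'^T = 0.
Proof.
move=> HH HH' /(congr1 (fun X => H *m X *m H'^T)).
by rewrite mulmx0 mul0mx !mulmxA HH mul1mx -!mulmxA HH' mulmx1.
Qed.

(** The two eigenspaces of a symmetric idempotent, with orthonormal bases. *)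
Lemma idempotent_frames (C : numClosedFieldType) n (E : 'M[C]_n) :
  E^T = E -> E *m E = E ->
  exists p q (H1 : 'M_(p, n)) (H2 : 'M_(q, n)),
    [/\ (p + q)%N = n,
        [/\ H1 *m H1^T = 1%:M /\ H2 *m H2^T = 1%:M,
            H1 *m H2^T = 0 & H2 *m H1^T = 0],
        H1^T *m H1 = E /\ H2^T *m H2 = 1%:M - E &
        [/\ H1 *m E = H1, H2 *m E = 0,
            H1 *m (1%:M - E) = 0 & H2 *m (1%:M - E) = H2]].
Proof.
move=> sE EE.
have EE' : (1%:M - E) *m (1%:M - E) = 1%:M - E.
  by rewrite mulmxBl mul1mx mulmxBr mulmx1 EE subrr subr0.
have sE' : (1%:M - E)^T = 1%:M - E by rewrite linearB /= trmx1 sE.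
have [p [H1 [H11 EH1]]] := orthonormal_idempotent sE EE.
have [q [H2 [H22 EH2]]] := orthonormal_idempotent sE' EE'.
have H12 : H1 *m H2^T = 0.
  apply: (orthogonal_projections_frames H11 H22).
  by rewrite EH1 EH2 mulmxBr mulmx1 EE subrr.
have H21 := orthogonal_sym H12.
have H1E : H1 *m E = H1 by rewrite -EH1 mulmxA H11 mul1mx.
have H2E : H2 *m E = 0 by rewrite -EH1 mulmxA H21 mul0mx.
have H1E' : H1 *m (1%:M - E) = 0 by rewrite mulmxBr mulmx1 H1E subrr.
have H2E' : H2 *m (1%:M - E) = H2 by rewrite mulmxBr mulmx1 H2E subr0.
exists p, q, H1, H2; split=> //.
apply: (@orthonormal_frame_size _ _ _ (col_mx H1 H2)).
  by rewrite tr_col_mx mul_col_row H11 H12 H21 H22 -scalar_mx_block.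
by rewrite tr_col_mx mul_row_col EH1 EH2 addrC subrK.
Qed.

(** Multiplying by E on either side gives E X = - E X E = X E.  Hence a vanishing
Jordan product with an idempotent is a vanishing associative product. *)
Lemma idempotent_anticommute (K : numFieldType) n (E X : 'M[K]_n) :
  E *m E = E -> E *m X + X *m E = 0 -> E *m X = 0 /\ X *m E = 0.
Proof.
move=> EE EX.
have E1 : E *m X + E *m X *m E = 0.
  by have := congr1 (mulmx E) EX; rewrite mulmxDr !mulmxA EE mulmx0.
have E2 : E *m X *m E + X *m E = 0.
  by have := congr1 (mulmx^~ E) EX; rewrite /= mulmxDl -!mulmxA EE mul0mx.
have eqEX : E *m X = X *m E.
  by apply: (addIr (E *m X *m E)); rewrite E1 addrC E2.
move: EX; rewrite eqEX -mulr2n => /eqP.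
by rewrite -scaler_nat scaler_eq0 pnatr_eq0 => /eqP.
Qed.

(** * Nilpotent symmetric matrices *)

(** The Gram matrix of N^m on a chain v, v N, ..., v N^d for which the number
v N^k v^T is 1 if k = d and 0 otherwise. *)
Definition hankel_mx (K : fieldType) (d m : nat) : 'M[K]_d.+1 :=
  \matrix_(i, j) ((i + j + m)%N == d)%:R.

Lemma antidiag_mxK (K : fieldType) p : antidiag_mx K p *m antidiag_mx K p = 1%:M.
Proof.
apply/matrixP => i j; rewrite !mxE (bigD1 (rev_ord i)) //= big1 => [|k ki].
  rewrite !mxE addr0 /= (_ : (i + _).+1 == p)%N; last by have := ltn_ord i; lia.
  by rewrite mul1r; congr (nat_of_bool _)%:R; rewrite -val_eqE /=;
    have := ltn_ord i; lia.
rewrite !mxE (_ : (_ == p) = false) ?mul0r //.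
apply: contraNF ki => /eqP E; rewrite -val_eqE /=; apply/eqP.
by move: E; have := ltn_ord i; lia.
Qed.

Lemma antidiag_mx_sym (K : fieldType) p : (antidiag_mx K p)^T = antidiag_mx K p.
Proof. by apply/matrixP => i j; rewrite !mxE addnC. Qed.

Lemma hankel_mx0 (K : fieldType) d : hankel_mx K d 0 = antidiag_mx K d.+1.
Proof. by apply/matrixP => i j; rewrite !mxE addn0 eqSS. Qed.

Lemma mulmx_exp (K : fieldType) n (N : 'M[K]_n) k l :
  N ^+ k *m N ^+ l = N ^+ (k + l).
Proof. by rewrite exprD. Qed.

Lemma trmx_exp (K : fieldType) n (N : 'M[K]_n) k : (N ^+ k)^T = N^T ^+ k.
Proof.
elim: k => [|k IH]; first by rewrite !expr0 trmx1.
by rewrite exprS exprSr -!mulmxE trmx_mul IH.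
Qed.

Lemma expmx_nilpotent (K : fieldType) n (N : 'M[K]_n) d k :
  N ^+ d.+1 = 0 -> (d < k)%N -> N ^+ k = 0.
Proof. by move=> N0 /subnKC <-; rewrite exprD N0 mul0r. Qed.

(** Start with an orthonormal system V for the form of N^d, and correct the values
V N^t V^T for t = d - 1, d - 2, ... in turn.  Adding a V N^(d - t) to V changes
V N^t V^T by a + a^T and leaves the values for higher exponents alone, so that
a = - (V N^t V^T) / 2 is the correction. *)
Lemma nilpotent_chain_gram (C : numClosedFieldType) n (N : 'M[C]_n) d :
  N^T = N -> N ^+ d.+1 = 0 ->
  exists V : 'M_(\rank (N ^+ d), n),
    forall m, V *m N ^+ m *m V^T = ((m == d)%:R)%:M.
Proof.
move=> sN N0.
suff /(_ d) [V VN] : forall s, exists V : 'M_(\rank (N ^+ d), n),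
    forall m, (d <= m + s)%N -> V *m N ^+ m *m V^T = ((m == d)%:R)%:M.
  by exists V => m; apply: VN; apply: leq_addl.
(* s is the number of corrections made so far. *)
elim=> [|s [V VN]].
  have [V VN] := symm_gram_identity (etrans (trmx_exp N d) (congr1 (fun M => M ^+ d) sN)).
  exists V => m; rewrite addn0 leq_eqVlt => /orP[/eqP <-|dm].
    by rewrite VN eqxx.
  by rewrite (expmx_nilpotent N0 dm) mulmx0 mul0mx gtn_eqF // raddf0.
have [ds|sd] := leqP d s.
  by exists V => m _; apply: VN; rewrite (leq_trans ds) ?leq_addl.
pose t := (d - s.+1)%N; have dE : d = (t + s.+1)%N by rewrite subnK.
pose c := V *m N ^+ t *m V^T; pose a := - 2%:R^-1 *: c.
have sc : c^T = c by rewrite !trmx_mul trmxK trmx_exp sN mulmxA.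
have sa : a^T = a by rewrite linearZ /= sc.
have ca : c + a + a = 0.
  rewrite /a -addrA -scalerDl -{1}[c]scale1r -scalerDl.
  by rewrite (_ : 1 + _ = 0) ?scale0r //; field.
exists (V + a *m V *m N ^+ s.+1) => m dm.
pose w k := V *m N ^+ k *m V^T.
have -> : (V + a *m V *m N ^+ s.+1) *m N ^+ m *m (V + a *m V *m N ^+ s.+1)^T
    = w m + w (m + s.+1)%N *m a + (a *m w (s.+1 + m)%N
      + a *m w (s.+1 + m + s.+1)%N *m a).
  rewrite linearD /= !trmx_mul trmx_exp sN sa /w -!mulmx_exp.
  by rewrite !(mulmxDl, mulmxDr) !mulmxA.
have wE k : (d <= k + s)%N -> w k = ((k == d)%:R)%:M by apply: VN.
rewrite (wE (s.+1 + m + s.+1)%N); last by lia.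
rewrite (wE (s.+1 + m)%N); last by lia.
rewrite (wE (m + s.+1)%N); last by lia.
rewrite (_ : (s.+1 + m + s.+1 == d)%N = false); last by lia.
rewrite (addnC s.+1 m) raddf0 mulmx0 mul0mx addr0.
rewrite [in (m + s.+1 == d)%N]dE eqn_add2r.
have [->|mt] := eqVneq m t.
  by rewrite mul1mx mulmx1 -/c ca (_ : (t == d) = false) ?raddf0 //; lia.
by rewrite raddf0 mul0mx mulmx0 !addr0 wE //; lia.
Qed.

(** The rows of d systems of a vectors each, listed in the order prescribed by f.
This order decides which factor of a Kronecker product comes first in the Gram
matrix. *)
Definition stack_mx (K : fieldType) m a d n (f : 'I_m -> 'I_a * 'I_d)
    (B : 'I_d -> 'M[K]_(a, n)) : 'M[K]_(m, n) :=
  \matrix_(r, c) B (f r).2 (f r).1 c.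

Lemma stack_mx_gram (K : fieldType) m a d n p m' a' (f : 'I_m -> 'I_a * 'I_d)
    (B : 'I_d -> 'M[K]_(a, n)) (X : 'M_(n, p)) (f' : 'I_m' -> 'I_a' * 'I_d)
    (B' : 'I_d -> 'M[K]_(a', p)) r s :
  (stack_mx f B *m X *m (stack_mx f' B')^T) r s
  = (B (f r).2 *m X *m (B' (f' s).2)^T) (f r).1 (f' s).1.
Proof.
rewrite [LHS]mxE [RHS]mxE; apply: eq_bigr => l _; congr (_ * _); last by rewrite !mxE.
by rewrite [LHS]mxE [RHS]mxE; apply: eq_bigr => k _; rewrite mxE.
Qed.

(** Chain after chain, so that the Gram matrix is block-diagonal with one block for
each chain. *)
Definition chain_mx (K : fieldType) a n (V : 'M[K]_(a, n)) (N : 'M[K]_n) d :=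
  stack_mx (@mxtens_unindex a d.+1) (fun j => V *m N ^+ j).

Lemma chain_mx_gram (K : fieldType) a n (V : 'M[K]_(a, n)) (N : 'M[K]_n) d m :
  N^T = N -> (forall k, V *m N ^+ k *m V^T = ((k == d)%:R)%:M) ->
  chain_mx V N d *m N ^+ m *m (chain_mx V N d)^T
  = tensmx 1%:M (hankel_mx K d m).
Proof.
move=> sN VN; apply/matrixP => r c; rewrite stack_mx_gram.
set i := mxtens_unindex r; set j := mxtens_unindex c.
rewrite trmx_mul trmx_exp sN mulmxA -(mulmxA V) mulmx_exp -(mulmxA V) mulmx_exp.
rewrite VN !mxE -/i -/j addnAC.
by case: (i.1 == j.1); rewrite ?mul1r ?mul0r.
Qed.

(** The chains span an N-stable subspace with invertible Gram matrix, so N also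
preserves the orthogonal complement.  As the chains exhaust the image of N^d, the
restriction N' of N to the complement satisfies N'^d = 0. *)
Lemma nilpotent_split (C : numClosedFieldType) n (N : 'M[C]_n) d :
  N^T = N -> N ^+ d.+1 = 0 ->
  exists p (Q : 'M_(\rank (N ^+ d) * d.+1 + p, n)) (N' : 'M_p),
    [/\ N'^T = N', N' ^+ d = 0, (\rank (N ^+ d) * d.+1 + p = n)%N,
       Q *m Q^T \in unitmx &
       forall m, Q *m N ^+ m *m Q^T
         = Diag (tensmx 1%:M (hankel_mx C d m)) (N' ^+ m)].
Proof.
move=> sN N0; have := nilpotent_chain_gram sN N0.
move Ea: (\rank (N ^+ d)) => a [V VN].
set H := chain_mx V N d; have HNH := chain_mx_gram _ sN VN.
have HH : H *m H^T \in unitmx.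
  have -> : H *m H^T = tensmx 1%:M (hankel_mx C d 0).
    by rewrite -(HNH 0%N) expr0 mulmx1.
  have : tensmx 1%:M (hankel_mx C d 0) *m tensmx 1%:M (hankel_mx C d 0)
         = 1%:M :> 'M_(a * d.+1).
    rewrite tensmx_mul hankel_mx0 antidiag_mxK mulmx1; apply/matrixP => r c.
    case: (mxtens_indexP r) => i j; case: (mxtens_indexP c) => k l.
    rewrite tensmxE !mxE (can_eq (@mxtens_indexK _ _)) xpair_eqE.
    by rewrite -natrM mulnb.
  by case/mulmx1_unit.
have [p [W [pE WH WW WK]]] := orthonormal_complement HH.
have rowsH k (r : 'I_a) : (row r (V *m N ^+ k) <= H)%MS.
  have [kd|dk] := ltnP k d.+1; last first.
    by rewrite (expmx_nilpotent N0 dk) mulmx0 row0 sub0mx.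
  apply: submx_trans (row_sub (mxtens_index (r, Ordinal kd)) _).
  suff -> : row r (V *m N ^+ k) = row (mxtens_index (r, Ordinal kd)) H by [].
  by apply/rowP => c; rewrite [RHS]mxE [RHS]mxE mxtens_indexK [LHS]mxE.
have WV k : W *m (V *m N ^+ k)^T = 0.
  have /submxP[D ->] : (V *m N ^+ k <= H)%MS by apply/row_subP.
  by rewrite trmx_mul mulmxA WH mul0mx.
have WNV k l : W *m N ^+ l *m (V *m N ^+ k)^T = 0.
  rewrite -mulmxA -{1}sN -trmx_exp -trmx_mul -mulmxA mulmx_exp; exact: WV.
have WNH l : W *m N ^+ l *m H^T = 0.
  apply/matrixP => r c; have [i j] := mxtens_indexP c.
  rewrite [RHS]mxE; have /matrixP/(_ r i) := WNV j l; rewrite [RHS]mxE => <-.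
  rewrite [LHS]mxE [RHS]mxE; apply: eq_bigr => k _; congr (_ * _).
  by rewrite mxE [RHS]mxE mxE mxtens_indexK.
(* The image of N^d is spanned by the last vectors of the chains. *)
have WNd : W *m N ^+ d = 0.
  have /submxP[D ED] : (N ^+ d <= V *m N ^+ d)%MS.
    rewrite -(geq_leqif (mxrank_leqif_sup _)) ?submxMl // Ea row_leq_rank.
    by apply: (@gram_row_free _ _ _ _ _ 1%:M V^T); rewrite mulmx1 VN eqxx unitmx1.
  have -> : W *m N ^+ d = W *m N ^+ d *m V^T *m D^T.
    have := congr1 trmx ED; rewrite !trmx_mul trmx_exp sN => ED'.
    by rewrite [in LHS]ED' !mulmxA.
  by have := WNV 0%N d; rewrite expr0 mulmx1 => ->; rewrite mul0mx.
pose N' := W *m N *m W^T.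
have WP l : W^T *m W *m N ^+ l *m W^T = N ^+ l *m W^T.
  apply: trmx_inj; rewrite !trmx_mul trmxK trmx_exp sN !mulmxA.
  exact: WK (WNH l).
have WNW m : W *m N ^+ m *m W^T = N' ^+ m.
  elim: m => [|m IH]; first by rewrite !expr0 mulmx1.
  rewrite [in RHS]exprS -IH -mulmxE /N' -!mulmxA (mulmxA W^T) (mulmxA (W^T *m W)) WP.
  by rewrite exprS -mulmxE !mulmxA.
exists p, (col_mx H W), N'; split => //.
- by rewrite !trmx_mul trmxK sN mulmxA.
- by rewrite -WNW WNd mul0mx.
- rewrite tr_col_mx mul_col_row WH WW unitmxE det_ublock.
  by rewrite det1 mulr1 -unitmxE.
move=> m; rewrite mul_col_mx tr_col_mx mul_col_row HNH WNH WNW.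
rewrite (_ : H *m N ^+ m *m W^T = 0) //.
by apply: trmx_inj; rewrite !trmx_mul trmxK trmx_exp sN mulmxA WNH trmx0.
Qed.

(** * The extension theorem of Witt for isotropic subspaces *)

Lemma invmx_mul (K : fieldType) n (A B : 'M[K]_n) :
  A \in unitmx -> B \in unitmx -> invmx (A *m B) = invmx B *m invmx A.
Proof.
move=> uA uB; have uAB : A *m B \in unitmx by rewrite unitmx_mul uA.
apply: (can_inj (mulKmx uAB)).
by rewrite mulmxV // mulmxA -(mulmxA A) mulmxV // mulmx1 mulmxV.
Qed.

(** Any D0 dual to B can be made isotropic by subtracting (D0 D0^T / 2) B; then B
and D span a hyperbolic space, and W is an orthonormal basis of the
complement. *)
Lemma hyperbolic_completion (C : numClosedFieldType) k n (B : 'M[C]_(k, n)) :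
  row_free B -> B *m B^T = 0 ->
  exists s (D : 'M_(k, n)) (W : 'M_(s, n)), (k + k + s = n)%N /\
    col_mx (col_mx B D) W *m (col_mx (col_mx B D) W)^T
      = Diag (block_mx 0 1%:M 1%:M 0) 1%:M.
Proof.
case/row_freeP => D0 BD0 BB.
pose c := D0^T *m D0; pose D := D0^T - (2%:R^-1 *: c) *m B.
have sc : c^T = c by rewrite trmx_mul trmxK.
have DB : D *m B^T = 1%:M.
  rewrite mulmxBl -mulmxA BB mulmx0 subr0.
  by apply: trmx_inj; rewrite trmx_mul !trmxK BD0 trmx1.
have BD : B *m D^T = 1%:M by apply: trmx_inj; rewrite trmx_mul trmxK DB trmx1.
have DD : D *m D^T = 0.
  rewrite {2}/D linearB /= trmxK trmx_mul linearZ /= sc mulmxBr mulmxA DB mul1mx.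
  rewrite mulmxBl -/c -mulmxA BD0 mulmx1 -{1}[c]scale1r -!scalerBl.
  by rewrite (_ : _ - _ = 0) ?scale0r //; field.
have [] := @orthonormal_complement _ _ _ (col_mx B D).
  rewrite tr_col_mx mul_col_row BB BD DB DD.
  suff: block_mx 0 1%:M 1%:M 0 *m block_mx 0 1%:M 1%:M 0 = 1%:M :> 'M[C]_(k + k).
    by case/mulmx1_unit.
  by rewrite mulmx_block !mul0mx !mulmx0 !mulmx1 !add0r !addr0 -scalar_mx_block.
move=> s [W [kE WH WW _]]; exists s, D, W; split => //.
rewrite tr_col_mx mul_col_row WW WH (orthogonal_sym WH).
by rewrite tr_col_mx mul_col_row BB BD DB DD.
Qed.

(** Two isotropic systems of the same size have hyperbolic completions with the same
Gram matrix, and the change of basis between the completions is orthogonal. *)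
Lemma witt_isotropic (C : numClosedFieldType) k n (B B' : 'M[C]_(k, n)) :
  row_free B -> B *m B^T = 0 -> row_free B' -> B' *m B'^T = 0 ->
  exists2 P : 'M_n, P *m P^T = 1%:M & B' *m P = B.
Proof.
move=> fB BB fB' BB'.
have [s [D [W [sE]]]] := hyperbolic_completion fB BB.
have [s' [D' [W' [sE']]]] := hyperbolic_completion fB' BB'.
have es : s' = s by lia.
case: _ / es sE W => sE W {sE}.
case: n / sE' B B' fB BB fB' BB' D W D' W' => B B' _ _ _ _ D W D' W'.
set T := col_mx (col_mx B D) W; set T' := col_mx (col_mx B' D') W'.
set K := Diag _ _ => KT' KT.
have uK : K \in unitmx.
  suff: K *m K = 1%:M by case/mulmx1_unit.
  rewrite /K /Diag !mulmx_block !mul0mx !mulmx0 !mulmx1 !add0r !addr0.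
  by rewrite -!scalar_mx_block.
have uT' : T' \in unitmx.
  by move: uK; rewrite -KT' unitmx_mul => /andP[].
have uTT : T'^T \in unitmx by rewrite unitmx_tr.
exists (invmx T' *m T).
  rewrite trmx_mul trmx_inv mulmxA -(mulmxA _ T) KT -KT'.
  by rewrite mulKmx // mulmxV.
have : T' *m (invmx T' *m T) = T by rewrite mulKVmx.
by rewrite {1 3}/T' /T !mul_col_mx => /eq_col_mx[/eq_col_mx[]].
Qed.

(** The rows of P form a basis with Gram matrix S in which the vectors B have
prescribed scalar products D with the basis.  With S = G G^T, the system
D G^-T is isotropic for the standard form, so the orthogonal version applies. *)
Lemma witt_isotropic_form (C : numClosedFieldType) k n (S : 'M[C]_n)
    (B D : 'M[C]_(k, n)) :
  S^T = S -> S \in unitmx -> row_free B -> B *m B^T = 0 ->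
  row_free D -> D *m invmx S *m D^T = 0 ->
  exists2 P : 'M_n, P *m P^T = S & P *m B^T = D^T.
Proof.
move=> sS uS fB BB fD DD; have [G uG SG] := symm_gram_factor sS uS.
have uGT : G^T \in unitmx by rewrite unitmx_tr.
have [||P PP PB] := @witt_isotropic _ _ _ B (D *m invmx G^T) fB BB.
- by rewrite /row_free mxrankMfree ?row_free_unit ?unitmx_inv.
- rewrite trmx_mul !trmx_inv trmxK mulmxA -(mulmxA D) -DD.
  by rewrite SG invmx_mul.
exists (G *m P); first by rewrite trmx_mul mulmxA -(mulmxA G) PP mulmx1.
rewrite -PB !trmx_mul trmx_inv trmxK (mulmxA _ P^T) -(mulmxA G P) PP mulmx1.
by rewrite mulKVmx.
Qed.

(** * Embeddings as symmetric representations *)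

Definition symmetric_rep (C : numFieldType) (A : jordanAlgebra C) n
    (g : A -> 'M[C]_n) : Prop :=
  [/\ linear g, injective g, forall a, (g a)^T = g a,
      forall a b, g a *m g b + g b *m g a = 2%:R *: g (jmul a b) &
      g (jone A) = 1%:M].

(** Dividing by the square root G of the unit U replaces the product with U^-1 in
the middle by the ordinary anticommutator. *)
Lemma embedding_symmetric_rep (C : numClosedFieldType) (A : jordanAlgebra C) n
    (L : set 'M[C]_n) :
  is_embedding A L ->
  exists2 G : 'M_n, G \in unitmx & exists2 g : A -> 'M_n, symmetric_rep g &
    L = range (fun a => G *m g a *m G^T).
Proof.
case=> U [uU [f [[lf mf f1] fI ->]]].
have sU : (U : 'M_n)^T = U by apply/eqP; apply: symvalP.
have [G uG UG] := symm_gram_factor sU uU.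
have uGT : G^T \in unitmx by rewrite unitmx_tr.
pose h X := invmx G *m X *m invmx G^T.
have hK X : G *m h X *m G^T = X by rewrite /h -!mulmxA mulKVmx // mulVmx // mulmx1.
exists G => //; exists (fun a => h (f a)); last first.
  have -> // : (fun a => G *m h (f a) *m G^T) = (fun a => symval (f a)).
  by apply/funext => a; rewrite hK.
have hl : linear h.
  by move=> x X Y; rewrite /h mulmxDr mulmxDl -scalemxAr -scalemxAl.
have hM X Y : h X *m h Y = h (X *m invmx U *m Y).
  by rewrite /h UG invmx_mul // !mulmxA.
split.
- by move=> x a b; rewrite lf -hl.
- by move=> a b /(congr1 (fun X => G *m X *m G^T)); rewrite !hK => /val_inj /fI.
- move=> a; rewrite /h !trmx_mul !trmx_inv trmxK !mulmxA.
  by congr (_ *m _ *m _); apply/eqP; apply: symvalP.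
- move=> a b; rewrite mf !hM /= /bullet_mx.
  by rewrite /h -scalemxAr -scalemxAl scalerA divff ?pnatr_eq0 // scale1r
    mulmxDr mulmxDl.
by rewrite f1 /h /= [in LHS]UG mulmxA mulVmx // mul1mx mulmxV.
Qed.

Definition mxspan3 (K : fieldType) n (X Y Z : 'M[K]_n) : set 'M[K]_n :=
  [set M | exists x y z : K, M = x *: X + y *: Y + z *: Z]%classic.

Lemma mxspan3_swap12 (K : fieldType) n (X Y Z : 'M[K]_n) :
  mxspan3 X Y Z = mxspan3 Y X Z.
Proof.
by apply/seteqP; split=> _ [x [y [z ->]]]; exists y, x, z; rewrite (addrC (_ *: Y)).
Qed.

Lemma mxspan3_swap23 (K : fieldType) n (X Y Z : 'M[K]_n) :
  mxspan3 X Y Z = mxspan3 X Z Y.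
Proof.
by apply/seteqP; split=> _ [x [y [z ->]]]; exists x, z, y; rewrite addrAC.
Qed.

Lemma rep_image_span3 (C : numFieldType) (A : jordanAlgebra C) n (G : 'M_n)
    (g : A -> 'M[C]_n) (a b c : A) :
  linear g -> (forall u, exists x y z : C, u = x *: a + y *: b + z *: c) ->
  range (fun u => G *m g u *m G^T)
  = [set G *m M *m G^T | M in mxspan3 (g a) (g b) (g c)]%classic.
Proof.
move=> lg gen.
have g0 : g 0 = 0.
  by have := lg (-1) 0 0; rewrite scaler0 addr0 scaleN1r addNr.
have gE x y z : g (x *: a + y *: b + z *: c) = x *: g a + y *: g b + z *: g c.
  by rewrite -addrA lg lg -[z *: c]addr0 lg g0 addr0 addrA.
apply/seteqP; split=> [_ [u _ <-]|_ [_ [x [y [z ->]]] <-]].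
  have [x [y [z ->]]] := gen u.
  by exists (g (x *: a + y *: b + z *: c)) => //; exists x, y, z; rewrite gE.
by exists (x *: a + y *: b + z *: c); rewrite ?gE.
Qed.

(** Q is rectangular with m equal to n as numbers only, because the sizes of the
block forms are sums which are not convertible to n. *)
Lemma congruent_span3 (C : fieldType) m n (G : 'M[C]_n) (X Y Z : 'M_n)
    (X' Y' Z' : 'M_m) (Q : 'M_(m, n)) :
  G \in unitmx -> m = n -> Q *m Q^T \in unitmx ->
  Q *m X *m Q^T = X' -> Q *m Y *m Q^T = Y' -> Q *m Z *m Q^T = Z' ->
  exists e, congruent e [set G *m M *m G^T | M in mxspan3 X Y Z]%classic
    (mxspan3 X' Y' Z').
Proof.
move=> uG e; case: _ / e in G uG X Y Z Q * => uQ <- <- <-.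
have QE x y z : x *: (Q *m X *m Q^T) + y *: (Q *m Y *m Q^T) + z *: (Q *m Z *m Q^T)
    = (Q *m invmx G) *m (G *m (x *: X + y *: Y + z *: Z) *m G^T) *m (Q *m invmx G)^T.
  rewrite trmx_mul trmx_inv !mulmxA mulmxK ?unitmx_tr // mulmxKV //.
  by rewrite !(mulmxDr, mulmxDl) -!scalemxAr -!scalemxAl.
exists (erefl _), (Q *m invmx G).
  rewrite unitmx_mul unitmx_inv uG andbT.
  by move: uQ; rewrite unitmx_mul => /andP[].
apply/seteqP; split=> [_ [_ [x [y [z ->]]] <-]|_ [_ [_ [x [y [z ->]]] <-] <-]].
  rewrite castmx_id QE; exists (G *m (x *: X + y *: Y + z *: Z) *m G^T) => //.
  by exists (x *: X + y *: Y + z *: Z) => //; exists x, y, z.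
by rewrite -QE; eexists; [exists x, y, z; reflexivity | rewrite castmx_id].
Qed.

(** * Block matrices and the normal forms as spans *)

Lemma conj_col_mx (K : fieldType) m1 m2 n (A : 'M[K]_(m1, n)) (B : 'M_(m2, n))
    (X : 'M_n) :
  col_mx A B *m X *m (col_mx A B)^T
  = block_mx (A *m X *m A^T) (A *m X *m B^T) (B *m X *m A^T) (B *m X *m B^T).
Proof. by rewrite mul_col_mx tr_col_mx mul_col_row. Qed.

Lemma conj_Diag (K : fieldType) m1 m2 n1 n2 (P : 'M[K]_(m1, n1))
    (Q : 'M_(m2, n2)) (X : 'M_n1) (Y : 'M_n2) :
  block_mx P 0 0 Q *m Diag X Y *m (block_mx P 0 0 Q)^T
  = Diag (P *m X *m P^T) (Q *m Y *m Q^T).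
Proof.
rewrite /Diag tr_block_mx !trmx0 !mulmx_block.
by rewrite !(mul0mx, mulmx0, addr0, add0r).
Qed.

Lemma gram_col_mx0 (K : fieldType) m1 m2 p (Y : 'M[K]_(m1, p)) :
  col_mx Y (0 : 'M_(m2, p)) *m (col_mx Y 0)^T = Diag (Y *m Y^T) 0.
Proof. by rewrite tr_col_mx mul_col_row trmx0 !mulmx0 !mul0mx. Qed.

Lemma gram_col_0mx (K : fieldType) m1 m2 p (Y : 'M[K]_(m2, p)) :
  col_mx (0 : 'M_(m1, p)) Y *m (col_mx 0 Y)^T = Diag 0 (Y *m Y^T).
Proof. by rewrite tr_col_mx mul_col_row trmx0 !mulmx0 !mul0mx. Qed.

Lemma unitmx_Diag (K : fieldType) m n (A : 'M[K]_m) (B : 'M_n) :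
  (Diag A B \in unitmx) = (A \in unitmx) && (B \in unitmx).
Proof. by rewrite !unitmxE det_ublock unitrM. Qed.

Lemma scale_Diag (K : fieldType) m n a (A : 'M[K]_m) (B : 'M_n) :
  a *: Diag A B = Diag (a *: A) (a *: B).
Proof. by rewrite /Diag scale_block_mx !scaler0. Qed.

Lemma add_Diag (K : fieldType) m n (A A' : 'M[K]_m) (B B' : 'M_n) :
  Diag A B + Diag A' B' = Diag (A + A') (B + B').
Proof. by rewrite /Diag add_block_mx !addr0. Qed.

Lemma A1_span (K : fieldType) k1 k2 k3 :
  A1 k1 k2 k3 = mxspan3 (Diag 1%:M (Diag 0 0)) (Diag 0 (Diag 1%:M 0))
    (Diag 0 (Diag 0 1%:M)) :> set 'M[K]_(_ + (_ + _)).
Proof.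
apply/seteqP; split=> _ [x [y [z ->]]]; exists x, y, z;
by rewrite !(scale_Diag, add_Diag, scaler0, addr0, add0r, scalemx1).
Qed.

Lemma A2_span (K : fieldType) r k1 k2 :
  A2 r k1 k2 = mxspan3 (Diag 1%:M 0)
    (Diag 0 (Diag (tensmx 1%:M (hankel_mx K 1 0)) 1%:M))
    (Diag 0 (Diag (tensmx 1%:M (hankel_mx K 1 1)) 0))
   :> set 'M[K]_(r + (k2 * 2 + k1)).
Proof.
have E y z : y *: tensmx 1%:M (hankel_mx K 1 0) + z *: tensmx 1%:M (hankel_mx K 1 1)
    = tensmx 1%:M (rows_mx 2 [:: [:: z; y]; [:: y; 0]]) :> 'M_(k2 * 2).
  apply/matrixP => i j; rewrite !mxE mulrCA (mulrCA z) -mulrDr; congr (_ * _).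
  move: (mxtens_unindex i).2 (mxtens_unindex j).2.
  move=> [[|[|//]] ?] [[|[|//]] ?] /=;
  by rewrite ?mulr1 ?mulr0 ?addr0 ?add0r.
apply/seteqP; split=> _ [x [y [z ->]]]; exists x, y, z;
by rewrite !(scale_Diag, add_Diag, scaler0, addr0, add0r, scalemx1) E.
Qed.

Lemma A3_span (K : fieldType) k1 k2 k3 :
  A3 k1 k2 k3 = mxspan3
    (Diag (tensmx 1%:M (hankel_mx K 2 0))
       (Diag (tensmx 1%:M (hankel_mx K 1 0)) 1%:M))
    (Diag (tensmx 1%:M (hankel_mx K 2 1))
       (Diag (tensmx 1%:M (hankel_mx K 1 1)) 0))
    (Diag (tensmx 1%:M (hankel_mx K 2 2)) (Diag 0 0))
   :> set 'M[K]_(k3 * 3 + (k2 * 2 + k1)).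
Proof.
have E3 x y z : x *: tensmx 1%:M (hankel_mx K 2 0)
      + y *: tensmx 1%:M (hankel_mx K 2 1) + z *: tensmx 1%:M (hankel_mx K 2 2)
    = tensmx 1%:M (rows_mx 3 [:: [:: z; y; x]; [:: y; x; 0]; [:: x; 0; 0]])
   :> 'M_(k3 * 3).
  apply/matrixP => i j; rewrite !mxE mulrCA (mulrCA y) (mulrCA z) -!mulrDr.
  congr (_ * _); move: (mxtens_unindex i).2 (mxtens_unindex j).2.
  move=> [[|[|[|//]]] ?] [[|[|[|//]]] ?] /=;
  by rewrite ?mulr1 ?mulr0 ?addr0 ?add0r.
have E2 x y : x *: tensmx 1%:M (hankel_mx K 1 0) + y *: tensmx 1%:M (hankel_mx K 1 1)
    = tensmx 1%:M (rows_mx 2 [:: [:: y; x]; [:: x; 0]]) :> 'M_(k2 * 2).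
  apply/matrixP => i j; rewrite !mxE mulrCA (mulrCA y) -mulrDr; congr (_ * _).
  move: (mxtens_unindex i).2 (mxtens_unindex j).2.
  move=> [[|[|//]] ?] [[|[|//]] ?] /=;
  by rewrite ?mulr1 ?mulr0 ?addr0 ?add0r.
apply/seteqP; split=> _ [x [y [z ->]]]; exists x, y, z;
by rewrite !(scale_Diag, add_Diag, scaler0, addr0, add0r, scalemx1) E3 E2.
Qed.

Lemma ord2_cases (i : 'I_2) : i = 0 \/ i = 1.
Proof. by case: i => -[|[|//]] ip; [left | right]; apply: val_inj. Qed.

(** The coordinates are the two diagonal entries and the off-diagonal entry of a
symmetric 2 x 2 matrix. *)
Lemma B1_span (K : fieldType) m :
  B1 m = mxspan3 (tensmx (delta_mx 0 0) 1%:M) (tensmx (delta_mx 1 1) 1%:M)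
     (tensmx (\matrix_(i, j) (i != j)%:R) 1%:M) :> set 'M[K]_(2 * m).
Proof.
have E (x y z : K) : x *: delta_mx 0 0 + y *: delta_mx 1 1
    + z *: \matrix_(i, j) (i != j)%:R \in @symmx_pred K 2.
  rewrite unfold_in; apply/eqP/matrixP => i j.
  by rewrite !mxE !(eq_sym j) !(andbC (i == _)).
have F x y z : x *: tensmx (delta_mx 0 0) 1%:M + y *: tensmx (delta_mx 1 1) 1%:M
     + z *: tensmx (\matrix_(i, j) (i != j)%:R) 1%:M
   = tensmx (SymMx (E x y z)) 1%:M :> 'M_(2 * m).
  by apply/matrixP => i j; rewrite !mxE !mulrA -!mulrDl.
apply/seteqP; split=> [_ [S _ <-]|_ [x [y [z ->]]]].
  exists (symval S 0 0), (symval S 1 1), (symval S 0 1); rewrite F.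
  congr (tensmx _ _); apply/matrixP => i j; rewrite !mxE.
  have /eqP/matrixP sS := symvalP S.
  have S10 : symval S 1 0 = symval S 0 1 by rewrite -[RHS](sS 0 1) mxE.
  by case: (ord2_cases i) => ->; case: (ord2_cases j) => ->;
    rewrite ?S10 /= ?mulr1 ?mulr0 ?addr0 ?add0r.
by exists (SymMx (E x y z)); rewrite ?F.
Qed.

Lemma B2_span (K : fieldType) k l1 l2 :
  B2 k l1 l2 = mxspan3 (Diag (block_mx (antidiag_mx K l2) 0 0 0) 0)
    (Diag (block_mx 0 0 0 (antidiag_mx K l2)) 1%:M)
    (Diag (block_mx 0 (pid_mx k) (pid_mx k) 0) 0)
   :> set 'M[K]_(l2 + l2 + l1).
Proof.
apply/seteqP; split=> _ [x [y [z ->]]]; exists x, y, z;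
by rewrite !(scale_Diag, add_Diag, scale_block_mx, add_block_mx, scaler0, addr0,
  add0r, scalemx1).
Qed.

(** * Complementary idempotents *)

(** The concatenated bases form an orthonormal basis, in which the projections are
diagonal.  The multiplicities k_i are the differences of the sorted ranks. *)
Lemma three_idempotents_congruent (C : numClosedFieldType) n (G : 'M[C]_n)
    r1 r2 r3 (H1 : 'M_(r1, n)) (H2 : 'M_(r2, n)) (H3 : 'M_(r3, n)) :
  G \in unitmx ->
  H1 *m H1^T = 1%:M -> H2 *m H2^T = 1%:M -> H3 *m H3^T = 1%:M ->
  H1 *m H2^T = 0 -> H1 *m H3^T = 0 -> H2 *m H3^T = 0 ->
  H1^T *m H1 + H2^T *m H2 + H3^T *m H3 = 1%:M ->
  (0 < r3)%N -> (r3 <= r2)%N -> (r2 <= r1)%N ->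
  exists k1 k2 k3 : nat,
    [/\ (1 <= k3)%N, (k1 + 2 * k2 + 3 * k3 = n)%N &
      exists e, congruent e
        [set G *m M *m G^T | M in mxspan3 (H1^T *m H1) (H2^T *m H2) (H3^T *m H3)]%classic
        (A1 k1 k2 k3)].
Proof.
move=> uG H11 H22 H33 H12 H13 H23 Hsum r3_gt0 r32 r21.
have H21 := orthogonal_sym H12; have H31 := orthogonal_sym H13.
have H32 := orthogonal_sym H23.
pose k3 := r3; pose k2 := (r2 - r3)%N; pose k1 := (r1 - r2)%N.
have e1 : (r1 = k1 + k2 + k3)%N by rewrite /k1 /k2 /k3; lia.
have e2 : (r2 = k2 + k3)%N by rewrite /k2 /k3; lia.
have e3 : (r3 = k3)%N by [].
have k3_gt0 : (0 < k3)%N by [].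
clearbody k1 k2 k3; clear r3_gt0 r32 r21; subst r1 r2 r3.
pose Q := col_mx H1 (col_mx H2 H3).
have conjQ r (H : 'M_(r, n)) : Q *m (H^T *m H) *m Q^T = Q *m H^T *m (Q *m H^T)^T.
  by rewrite trmx_mul trmxK !mulmxA.
have Q1 : Q *m (H1^T *m H1) *m Q^T = Diag 1%:M (Diag 0 0).
  have QH : Q *m H1^T = col_mx 1%:M 0 by rewrite !mul_col_mx H11 H21 H31 ?col_mx0.
  by rewrite conjQ QH !(gram_col_mx0, gram_col_0mx) trmx1 mulmx1 ?/Diag ?block_mx0.
have Q2 : Q *m (H2^T *m H2) *m Q^T = Diag 0 (Diag 1%:M 0).
  have QH : Q *m H2^T = col_mx 0 (col_mx 1%:M 0) by rewrite !mul_col_mx H12 H22 H32 ?col_mx0.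
  by rewrite conjQ QH !(gram_col_mx0, gram_col_0mx) trmx1 mulmx1 ?/Diag ?block_mx0.
have Q3 : Q *m (H3^T *m H3) *m Q^T = Diag 0 (Diag 0 1%:M).
  have QH : Q *m H3^T = col_mx 0 (col_mx 0 1%:M) by rewrite !mul_col_mx H13 H23 H33 ?col_mx0.
  by rewrite conjQ QH !(gram_col_mx0, gram_col_0mx) trmx1 mulmx1 ?/Diag ?block_mx0.
have QQ : Q *m Q^T = 1%:M.
  rewrite -{1}[Q]mulmx1 -Hsum !mulmxDr !mulmxDl Q1 Q2 Q3 !add_Diag.
  by rewrite !(addr0, add0r) /Diag -!scalar_mx_block.
have en : (k1 + k2 + k3 + (k2 + k3 + k3) = n)%N.
  apply: (orthonormal_frame_size QQ).
  by rewrite /Q !tr_col_mx mul_row_col mul_row_col addrA.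
exists k1, k2, k3; split => //; first by lia.
by rewrite A1_span; apply: (@congruent_span3 _ _ _ _ _ _ _ _ _ _ Q); rewrite ?QQ ?unitmx1.
Qed.

(** * An idempotent and a nilpotent matrix orthogonal to it *)

(** N lives on the image of 1 - E, where it is brought to its normal form; on the
image of E an orthonormal basis is enough. *)
Lemma idempotent_square_zero_congruent (C : numClosedFieldType) n
    (G E N : 'M[C]_n) :
  G \in unitmx -> E^T = E -> E *m E = E -> E != 0 ->
  N^T = N -> E *m N = 0 -> N *m N = 0 -> N != 0 ->
  exists r k1 k2 : nat,
    [/\ (1 <= r)%N, (1 <= k2)%N, (r + (k1 + 2 * k2) = n)%N &
      exists e, congruent e
        [set G *m M *m G^T | M in mxspan3 E (1%:M - E) N]%classic
        (A2 r k1 k2)].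
Proof.
move=> uG sE EE E0 sN EN NN N0.
have [r [s [H1 [H2 [rs [[H11 H22] H12 H21] [EH1 EH2] [H1E H2E H1E' H2E']]]]]] :=
  idempotent_frames sE EE.
have NE : N *m E = 0 by apply: trmx_inj; rewrite trmx_mul sN sE EN trmx0.
have H1N : H1 *m N = 0.
  by rewrite -[H1]mul1mx -H11 -(mulmxA H1) EH1 -mulmxA EN mulmx0.
have NH1 : N *m H1^T = 0 by apply: trmx_inj; rewrite trmx_mul trmxK sN H1N trmx0.
pose N2 := H2 *m N *m H2^T.
have sN2 : N2^T = N2 by rewrite !trmx_mul trmxK sN mulmxA.
have N2N2 : N2 ^+ 2 = 0.
  rewrite expr2 -mulmxE /N2 -!mulmxA (mulmxA H2^T) EH2 (mulmxA (1%:M - E)).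
  by rewrite mulmxBl mul1mx EN subr0 (mulmxA N) NN mul0mx mulmx0.
have N2E : N = H2^T *m N2 *m H2.
  rewrite /N2 !mulmxA EH2 -!mulmxA EH2 mulmxBl mulmxBr !mulmx1 mul1mx NE subr0.
  by rewrite EN subr0.
have [p [Q [N3 [sN3 N30 pE uQ QN]]]] := nilpotent_split sN2 N2N2.
have N20 : N2 != 0 by apply: contra_neq N0 => N20; rewrite N2E N20 mulmx0 mul0mx.
rewrite expr1 in Q QN pE uQ; rewrite expr1 in N30.
have QN0 := QN 0%N; have QN1 := QN 1%N.
rewrite !expr1 N30 in QN1; rewrite !expr0 mulmx1 in QN0.
exists r, p, (\rank N2); split.
- by apply: (@frame_gt0 _ _ _ H1); rewrite EH1.
- by rewrite lt0n mxrank_eq0.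
- by move: rs pE; lia.
have conjT (X : 'M[C]_n) : col_mx H1 (Q *m H2) *m X *m (col_mx H1 (Q *m H2))^T
  = block_mx (H1 *m X *m H1^T) (H1 *m X *m H2^T *m Q^T)
      (Q *m (H2 *m X *m H1^T)) (Q *m (H2 *m X *m H2^T) *m Q^T).
  by rewrite conj_col_mx !trmx_mul !mulmxA.
rewrite A2_span; apply: (@congruent_span3 _ _ _ _ _ _ _ _ _ _ (col_mx H1 (Q *m H2))).
- by [].
- by rewrite pE.
- rewrite -[X in X *m _]mulmx1 conjT !mulmx1 H11 H12 H21 H22 mul0mx mulmx0 mulmx1.
  by rewrite unitmx_Diag unitmx1.
- by rewrite conjT H1E H2E H11 H12 !(mul0mx, mulmx0).
- by rewrite conjT H1E' H2E' H21 H22 !(mul0mx, mulmx0) mulmx1 QN0.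
by rewrite conjT -!(mulmxA H2) NH1 H1N !mul0mx !mulmx0 mulmxA -/N2 QN1.
Qed.

(** Chains of length 3 are split off first, then those of length 2; N vanishes on
what remains. *)
Lemma cube_zero_congruent (C : numClosedFieldType) n (G N : 'M[C]_n) :
  G \in unitmx -> N^T = N -> N ^+ 3 = 0 -> N ^+ 2 != 0 ->
  exists k1 k2 k3 : nat,
    [/\ (1 <= k3)%N, (k1 + 2 * k2 + 3 * k3 = n)%N &
      exists e, congruent e
        [set G *m M *m G^T | M in mxspan3 1%:M N (N ^+ 2)]%classic
        (A3 k1 k2 k3)].
Proof.
move=> uG sN N3 N2.
have [p [Q [N' [sN' N'2 pE uQ QN]]]] := nilpotent_split sN N3.
have [p' [Q' [N'' [sN'' N''1 pE' uQ' QN']]]] := nilpotent_split sN' N'2.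
rewrite expr1 in N''1; rewrite expr1 in Q' QN' pE' uQ'.
exists p', (\rank N'), (\rank (N ^+ 2)); split.
- by rewrite lt0n mxrank_eq0.
- by move: pE pE'; lia.
pose T := block_mx 1%:M 0 0 Q' *m Q.
have conjT X : T *m X *m T^T = block_mx 1%:M 0 0 Q' *m (Q *m X *m Q^T)
    *m (block_mx 1%:M 0 0 Q')^T.
  by rewrite trmx_mul !mulmxA.
have TN m : T *m N ^+ m *m T^T = Diag (tensmx 1%:M (hankel_mx C 2 m))
    (Diag (tensmx 1%:M (hankel_mx C 1 m)) (N'' ^+ m)).
  by rewrite conjT QN conj_Diag mul1mx trmx1 mulmx1 QN'.
have T0 := TN 0%N; have T1 := TN 1%N; have T2 := TN 2.
rewrite !expr0 mulmx1 in T0; rewrite !expr1 N''1 in T1.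
rewrite [N'' ^+ 2]expr2 N''1 mul0r in T2.
(* N^2 vanishes on the chains of length 2. *)
have F12 : hankel_mx C 1 2 = 0.
  by apply/matrixP => i j; rewrite !mxE addn2.
rewrite F12 tensmx0 in T2.
rewrite A3_span; apply: (@congruent_span3 _ _ _ _ _ _ _ _ _ _ T) => //.
- by rewrite pE'.
- move: uQ; have := QN 0%N; rewrite !expr0 mulmx1 => ->.
  rewrite T0 !unitmx_Diag => /andP[-> _] /=.
  have := uQ'; have := QN' 0%N; rewrite !expr0 mulmx1 => ->.
  by rewrite unitmx_Diag.
by rewrite mulmx1.
Qed.

(** * Spin factors *)

(** The relation E Z + Z E = Z gives E Z E = 0 and (1 - E) Z (1 - E) = 0, so Z
exchanges the two eigenspaces of E. *)
Lemma spin_frames (C : numClosedFieldType) n (E Z : 'M[C]_n) (c : C) :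
  E^T = E -> E *m E = E -> Z^T = Z -> E *m Z + Z *m E = Z -> Z *m Z = c%:M ->
  exists p q (H1 : 'M_(p, n)) (H2 : 'M_(q, n)) (A : 'M_(p, q)),
    (p + q)%N = n /\
    let Q := col_mx H1 H2 in
    [/\ A *m A^T = c%:M, A^T *m A = c%:M,
        Q *m E *m Q^T = Diag 1%:M 0, Q *m (1%:M - E) *m Q^T = Diag 0 1%:M &
        Q *m Z *m Q^T = block_mx 0 A A^T 0].
Proof.
move=> sE EE sZ EZ ZZ.
have [p [q [H1 [H2 [en [[H11 H22] H12 H21] [EH1 EH2] [H1E H2E H1E' H2E']]]]]] :=
  idempotent_frames sE EE.
have EZE : E *m Z *m E = 0.
  have := congr1 (mulmx E) EZ; rewrite mulmxDr !mulmxA EE.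
  by rewrite -[RHS]addr0 => /addrI.
have EZE' : (1%:M - E) *m Z *m (1%:M - E) = 0.
  rewrite mulmxBr mulmx1 !mulmxBl !mul1mx EZE subr0 -{1}EZ.
  by rewrite addrAC addrK subrr.
have sE' : (1%:M - E)^T = 1%:M - E by rewrite linearB /= trmx1 sE.
have EH1T : E *m H1^T = H1^T by apply: trmx_inj; rewrite trmx_mul trmxK sE.
have EH2T : (1%:M - E) *m H2^T = H2^T.
  by apply: trmx_inj; rewrite trmx_mul trmxK sE'.
have HZ1 : H1 *m Z *m H1^T = 0.
  by rewrite -EH1T -H1E -!mulmxA (mulmxA Z) (mulmxA E) (mulmxA E Z) EZE !(mul0mx, mulmx0).
have HZ2 : H2 *m Z *m H2^T = 0.
  rewrite -EH2T -H2E' -!mulmxA (mulmxA Z) (mulmxA (1%:M - E)) (mulmxA (1%:M - E) Z).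
  by rewrite EZE' !(mul0mx, mulmx0).
pose A := H1 *m Z *m H2^T.
have AT : A^T = H2 *m Z *m H1^T by rewrite !trmx_mul trmxK sZ mulmxA.
exists p, q, H1, H2, A; split=> //; split.
- rewrite AT /A !mulmxA -(mulmxA _ H2^T) EH2 mulmxBr mulmx1 !mulmxBl.
  rewrite -EH1 !mulmxA HZ1 !mul0mx subr0 -(mulmxA H1) ZZ.
  by rewrite mul_mx_scalar -scalemxAl H11 scale_scalar_mx mulr1.
- rewrite AT /A !mulmxA -(mulmxA _ H1^T) EH1.
  have -> : E = 1%:M - H2^T *m H2 by rewrite EH2 opprB addrC subrK.
  rewrite mulmxBr mulmx1 !mulmxBl !mulmxA HZ2 !mul0mx subr0 -(mulmxA H2) ZZ.
  by rewrite mul_mx_scalar -scalemxAl H22 scale_scalar_mx mulr1.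
- by rewrite conj_col_mx H1E H2E H11 H12 !mul0mx.
- by rewrite conj_col_mx H1E' H2E' H21 H22 !mul0mx.
by rewrite conj_col_mx HZ1 HZ2 AT.
Qed.

(** A is orthogonal, so A H2 is again an orthonormal basis of the second eigenspace,
and Z matches it with the basis H1 of the first one. *)
Lemma spin_nondegenerate_congruent (C : numClosedFieldType) n (G E Z : 'M[C]_n) :
  G \in unitmx -> E^T = E -> E *m E = E -> Z^T = Z -> E *m Z + Z *m E = Z ->
  Z *m Z = 1%:M ->
  ~~ odd n /\ exists e, congruent e
    [set G *m M *m G^T | M in mxspan3 E (1%:M - E) Z]%classic (B1 n./2).
Proof.
move=> uG sE EE sZ EZ ZZ.
have [p [q [H1 [H2 [A [en [AA AA' QE QE' QZ]]]]]]] := spin_frames sE EE sZ EZ ZZ.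
have pq := orthonormal_frame_size AA AA'.
have en2 : (2 * p = n)%N by rewrite -en -pq; lia.
have -> : n./2 = p by lia.
split; first by lia.
move: QE QE' QZ; rewrite !conj_col_mx.
move=> /eq_block_mx[E11 E12 E21 E22] /eq_block_mx[F11 F12 F21 F22].
move=> /eq_block_mx[Z11 Z12 Z21 Z22].
pose B (i : 'I_2) := if i == 0 then H1 else A *m H2.
pose Q := stack_mx (fun r => ((@mxtens_unindex 2 p r).2, (@mxtens_unindex 2 p r).1)) B.
have QX (X : 'M_n) (F : 'M_2) :
    (forall i j, B i *m X *m (B j)^T = (F i j)%:M) ->
    Q *m X *m Q^T = tensmx F 1%:M.
  move=> BX; apply/matrixP => r s; rewrite stack_mx_gram /= BX !mxE.
  by rewrite mulr_natr.
have AXA X Y : A *m X *m Y *m (A *m X)^T = A *m (X *m Y *m X^T) *m A^T.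
  by rewrite trmx_mul !mulmxA.
have QQE : Q *m E *m Q^T = tensmx (delta_mx 0 0) 1%:M.
  apply: QX => i j; case: (ord2_cases i) => ->; case: (ord2_cases j) => ->; rewrite /B /= !mxE /=.
  - by rewrite E11.
  - by rewrite trmx_mul mulmxA E12 mul0mx raddf0.
  - by rewrite -!mulmxA (mulmxA H2) E21 mulmx0 raddf0.
  - by rewrite AXA E22 mulmx0 mul0mx raddf0.
have QQE' : Q *m (1%:M - E) *m Q^T = tensmx (delta_mx 1 1) 1%:M.
  apply: QX => i j; case: (ord2_cases i) => ->; case: (ord2_cases j) => ->; rewrite /B /= !mxE /=.
  - by rewrite F11 raddf0.
  - by rewrite trmx_mul mulmxA F12 mul0mx raddf0.
  - by rewrite -!mulmxA (mulmxA H2) F21 mulmx0 raddf0.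
  - by rewrite AXA F22 mulmx1 AA.
rewrite B1_span; apply: (@congruent_span3 _ _ _ _ _ _ _ _ _ _ Q) => //.
  have -> : Q *m Q^T = Q *m E *m Q^T + Q *m (1%:M - E) *m Q^T.
    by rewrite -mulmxDl -mulmxDr addrC subrK mulmx1.
  rewrite QQE QQE' (_ : _ + _ = 1%:M) ?unitmx1 //; apply/matrixP => r s.
  case: (mxtens_indexP r) => i j; case: (mxtens_indexP s) => k l.
  rewrite mxE !tensmxE !mxE (can_eq (@mxtens_indexK _ _)) xpair_eqE -mulrDl.
  by case: (ord2_cases i) => ->; case: (ord2_cases k) => ->; rewrite /= ?addr0 ?add0r ?mul1r ?mul0r.
apply: QX => i j; case: (ord2_cases i) => ->; case: (ord2_cases j) => ->; rewrite /B /= !mxE /=.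
- by rewrite Z11 raddf0.
- by rewrite trmx_mul mulmxA Z12 AA.
- by rewrite -!mulmxA (mulmxA H2) Z21 AA.
- by rewrite AXA Z22 mulmx0 mul0mx raddf0.
Qed.

Lemma pid_mx_row0 (K : fieldType) m p l k :
  (k <= p)%N -> pid_mx k = row_mx (pid_mx k) 0 :> 'M[K]_(m, p + l).
Proof.
move=> kp; apply/matrixP => i j; rewrite mxE [RHS]mxE.
case: splitP => c jc; rewrite mxE jc //.
by rewrite (_ : _ && _ = false) //; apply/negbTE; rewrite negb_and; lia.
Qed.

(** The first k coordinate vectors are isotropic for the antidiagonal form: two
indices below k never add up to p - 1. *)
Lemma pid_mx_antidiag (K : fieldType) k p : (2 * k <= p)%N ->
  (pid_mx k : 'M[K]_(k, p)) *m antidiag_mx K p *m (pid_mx k : 'M_(k, p))^T = 0.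
Proof.
move=> kp; apply/matrixP => i j; rewrite [RHS]mxE mxE big1 // => l _.
rewrite tr_pid_mx mxE; have [lj|] := boolP (l == j :> nat); last first.
  by move=> /negbTE E; rewrite [pid_mx _ _ _]mxE E andFb mulr0.
rewrite big1 ?mul0r // => l' _; rewrite !mxE.
have [il|] := boolP (i == l' :> nat); last by rewrite mul0r.
rewrite (_ : (_ == p) = false) ?mulr0 //.
by apply/eqP; move: (ltn_ord i) (ltn_ord j) lj il => ? ? /eqP -> /eqP <-; lia.
Qed.

(** In a rank factorization A = B^T D the equations A A^T = 0 and A^T A = 0 cancel
to D D^T = 0 and B B^T = 0.  The extension theorem puts B and D in the position of
the first coordinate vectors, relative to bases with the prescribed Gram
matrices. *)
Lemma isotropic_pair_normal_form (C : numClosedFieldType) p l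
    (A : 'M[C]_(p, p + l)) :
  A *m A^T = 0 -> A^T *m A = 0 ->
  (2 * \rank A <= p)%N /\
  exists (P1 : 'M_p) (P2 : 'M_(p + l)),
    [/\ P1 *m P1^T = antidiag_mx C p, P2 *m P2^T = Diag (antidiag_mx C p) 1%:M &
        P1 *m A *m P2^T = pid_mx (\rank A)].
Proof.
move=> AA AA'.
have [k [B [D [fB fD AE ->]]]] : exists k (B : 'M_(k, p)) (D : 'M_(k, p + l)),
    [/\ row_free B, row_free D, A = B^T *m D & \rank A = k].
  exists (\rank A), (col_base A)^T, (row_base A); split=> //.
  - by rewrite /row_free mxrank_tr; apply: col_base_full.
  - exact: row_base_free.
  - by rewrite trmxK mulmx_base.
have fullBT : row_full B^T by rewrite /row_full mxrank_tr; apply: fB.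
have DD : D *m D^T = 0.
  apply: (row_full_inj fullBT); apply: (row_free_inj fB).
  by rewrite /= mulmx0 mul0mx -AA AE trmx_mul trmxK !mulmxA.
have fullDT : row_full D^T by rewrite /row_full mxrank_tr; apply: fD.
have BB : B *m B^T = 0.
  apply: (row_full_inj fullDT); apply: (row_free_inj fD).
  by rewrite /= mulmx0 mul0mx -AA' AE trmx_mul trmxK !mulmxA.
have rA : (2 * k <= p)%N.
  have := mulmx0_rank_max BB; rewrite mxrank_tr.
  by move/eqP: fB => ->; rewrite addnn mul2n.
split => //.
have uJ : antidiag_mx C p \in unitmx by case: (mulmx1_unit (antidiag_mxK C p)).
have iJ : invmx (antidiag_mx C p) = antidiag_mx C p.
  by apply: (can_inj (mulKmx uJ)); rewrite mulmxV // antidiag_mxK.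
have fpid m : (k <= m)%N -> row_free (pid_mx k : 'M[C]_(k, m)).
  by move=> ?; rewrite /row_free rank_pid_mx.
have kp : (k <= p)%N by lia.
have pJ : (pid_mx k : 'M_(k, p)) *m invmx (antidiag_mx C p) *m (pid_mx k : 'M_(k, p))^T = 0.
  by rewrite iJ pid_mx_antidiag.
have [P1 P11 P1B] := witt_isotropic_form (antidiag_mx_sym C p) uJ fB BB (fpid p kp) pJ.
have KK : Diag (antidiag_mx C p) 1%:M *m Diag (antidiag_mx C p) 1%:M
    = 1%:M :> 'M_(p + l).
  rewrite /Diag mulmx_block !(mul0mx, mulmx0, mulmx1, addr0, add0r).
  by rewrite antidiag_mxK -scalar_mx_block.
have uK : Diag (antidiag_mx C p) (1%:M : 'M_l) \in unitmx.
  by rewrite unitmx_Diag uJ unitmx1.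
have iK : invmx (Diag (antidiag_mx C p) (1%:M : 'M_l)) = Diag (antidiag_mx C p) 1%:M.
  by apply: (can_inj (mulKmx uK)); rewrite mulmxV // KK.
have sK : (Diag (antidiag_mx C p) (1%:M : 'M_l))^T = Diag (antidiag_mx C p) 1%:M.
  by rewrite /Diag tr_block_mx !trmx0 trmx1 antidiag_mx_sym.
have kpl : (k <= p + l)%N by lia.
have pK : (pid_mx k : 'M_(k, p + l)) *m invmx (Diag (antidiag_mx C p) 1%:M)
    *m (pid_mx k : 'M_(k, p + l))^T = 0.
  rewrite iK pid_mx_row0 // /Diag mul_row_block !(mulmx0, mul0mx, addr0, add0r).
  by rewrite tr_row_mx mul_row_col pid_mx_antidiag // mul0mx add0r.
have [P2 P22 P2D] := witt_isotropic_form sK uK fD DD (fpid (p + l)%N kpl) pK.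
exists P1, P2; split => //.
rewrite AE -!mulmxA -[D *m _]trmxK trmx_mul trmxK P2D trmxK mulmxA P1B.
by rewrite tr_pid_mx pid_mx_id.
Qed.

(** The case where the first eigenspace is the smaller one. *)
Lemma spin_degenerate_oriented (C : numClosedFieldType) n p l (G E1 E2 Z : 'M[C]_n)
    (H1 : 'M_(p, n)) (H2 : 'M_(p + l, n)) (A : 'M_(p, p + l)) :
  G \in unitmx -> (p + (p + l) = n)%N -> E1 + E2 = 1%:M ->
  A *m A^T = 0 -> A^T *m A = 0 -> A != 0 ->
  let Q := col_mx H1 H2 in
  Q *m E1 *m Q^T = Diag 1%:M 0 -> Q *m E2 *m Q^T = Diag 0 1%:M ->
  Q *m Z *m Q^T = block_mx 0 A A^T 0 ->
  exists k l1 l2 : nat,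
    [/\ (2 <= l2)%N, (1 <= k)%N, (2 * k <= l2)%N, (l1 + 2 * l2 = n)%N &
      exists e, congruent e
        [set G *m M *m G^T | M in mxspan3 E1 E2 Z]%classic (B2 k l1 l2)].
Proof.
move=> uG en E12 AA AA' A0 Q QE1 QE2 QZ.
have [rA [P1 [P2 [P11 P22 PAP]]]] := isotropic_pair_normal_form AA AA'.
have rA0 : (0 < \rank A)%N by rewrite lt0n mxrank_eq0.
exists (\rank A), l, p; split => //; [by lia | by move: en; lia |].
pose Pa := usubmx P2; pose Pb := dsubmx P2.
have P2E : P2 = col_mx Pa Pb by rewrite vsubmxK.
pose T := col_mx (col_mx (P1 *m H1) (Pa *m H2)) (Pb *m H2).
have conjT X a b c d : Q *m X *m Q^T = block_mx a b c d ->
    T *m X *m T^T = block_mx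
      (block_mx (P1 *m a *m P1^T) (P1 *m b *m Pa^T)
                (Pa *m c *m P1^T) (Pa *m d *m Pa^T))
      (col_mx (P1 *m b *m Pb^T) (Pa *m d *m Pb^T))
      (row_mx (Pb *m c *m P1^T) (Pb *m d *m Pa^T)) (Pb *m d *m Pb^T).
  rewrite /Q conj_col_mx => /eq_block_mx[<- <- <- <-].
  rewrite /T conj_col_mx conj_col_mx mul_col_mx tr_col_mx mul_mx_row mul_col_mx.
  by rewrite !trmx_mul !mulmxA.
move: P22; rewrite P2E tr_col_mx mul_col_row => /eq_block_mx[Paa Pab Pba Pbb].
move: PAP; rewrite P2E tr_col_mx mul_mx_row pid_mx_row0; last by lia.
case/eq_row_mx=> [PAa PAb].
have PaA : Pa *m A^T *m P1^T = pid_mx (\rank A).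
  by apply: trmx_inj; rewrite !trmx_mul !trmxK mulmxA PAa tr_pid_mx.
have PbA : Pb *m A^T *m P1^T = 0.
  by apply: trmx_inj; rewrite !trmx_mul !trmxK mulmxA PAb trmx0.
have TE1 : T *m E1 *m T^T = Diag (block_mx (antidiag_mx C p) 0 0 0) 0.
  rewrite (conjT _ _ _ _ _ QE1) !(mulmx1, mulmx0, mul0mx) P11.
  by rewrite row_mx0 col_mx0.
have TE2 : T *m E2 *m T^T = Diag (block_mx 0 0 0 (antidiag_mx C p)) 1%:M.
  rewrite (conjT _ _ _ _ _ QE2) !(mulmx1, mulmx0, mul0mx) Paa Pab Pba Pbb.
  by rewrite row_mx0 col_mx0.
have TZ : T *m Z *m T^T
    = Diag (block_mx 0 (pid_mx (\rank A)) (pid_mx (\rank A)) 0) 0.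
  rewrite (conjT _ _ _ _ _ QZ) !(mulmx0, mul0mx) PAa PAb PaA PbA.
  by rewrite row_mx0 col_mx0.
rewrite B2_span; apply: (@congruent_span3 _ _ _ _ _ _ _ _ _ _ T) => //.
  by rewrite -addnA.
have -> : T *m T^T = T *m E1 *m T^T + T *m E2 *m T^T.
  by rewrite -mulmxDl -mulmxDr E12 mulmx1.
rewrite TE1 TE2 add_Diag add_block_mx !(addr0, add0r).
have [uJ _] := mulmx1_unit (antidiag_mxK C p).
by rewrite !unitmx_Diag uJ unitmx1.
Qed.

(** If the first eigenspace is the larger one, exchange E with 1 - E, that is, x
with y. *)
Lemma spin_degenerate_congruent (C : numClosedFieldType) n (G E Z : 'M[C]_n) :
  G \in unitmx -> E^T = E -> E *m E = E -> Z^T = Z -> E *m Z + Z *m E = Z ->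
  Z *m Z = 0 -> Z != 0 ->
  exists k l1 l2 : nat,
    [/\ (2 <= l2)%N, (1 <= k)%N, (2 * k <= l2)%N, (l1 + 2 * l2 = n)%N &
      exists e, congruent e
        [set G *m M *m G^T | M in mxspan3 E (1%:M - E) Z]%classic (B2 k l1 l2)].
Proof.
move=> uG sE EE sZ EZ ZZ Z0.
have ZZ' : Z *m Z = 0%:M by rewrite ZZ raddf0.
have [p [q [H1 [H2 [A [en [AA AA' QE QE' QZ]]]]]]] := spin_frames sE EE sZ EZ ZZ'.
rewrite !raddf0 in AA AA'.
have QQ : col_mx H1 H2 *m (col_mx H1 H2)^T = 1%:M.
  rewrite -{1}[col_mx H1 H2]mulmx1 -[X in _ *m X *m _](subrK E).
  by rewrite mulmxDr mulmxDl QE QE' add_Diag add0r addr0 /Diag -scalar_mx_block.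
have A0 : A != 0.
  apply: contra_neq Z0 => A0.
  rewrite A0 trmx0 block_mx0 in QZ.
  have fullQ : row_full (col_mx H1 H2).
    suff : row_free (col_mx H1 H2) by rewrite /row_full /row_free => /eqP ->; apply/eqP.
    by apply: (@gram_row_free _ _ _ _ _ 1%:M (col_mx H1 H2)^T); rewrite mulmx1 QQ unitmx1.
  have freeQ : row_free (col_mx H1 H2)^T by rewrite /row_free mxrank_tr; apply: fullQ.
  by apply: (row_full_inj fullQ); apply: (row_free_inj freeQ); rewrite /= mulmx0 mul0mx.
have [pq|qp] := leqP p q.
  have eq : (q = p + (q - p))%N by lia.
  move: (q - p)%N eq => l eq; subst q.
  apply: (spin_degenerate_oriented uG en _ AA AA' A0 QE QE' QZ).
  by rewrite addrC subrK.
have ep : (p = q + (p - q))%N by lia.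
move: (p - q)%N ep => l ep; subst p.
have AT0 : A^T != 0 by apply: contra_neq A0 => AT0; rewrite -[A]trmxK AT0 trmx0.
rewrite mxspan3_swap12.
move: QE QE' QZ; rewrite !conj_col_mx.
move=> /eq_block_mx[E11 E12 E21 E22] /eq_block_mx[F11 F12 F21 F22].
move=> /eq_block_mx[Z11 Z12 Z21 Z22].
apply: (@spin_degenerate_oriented _ _ _ _ _ _ _ _ H2 H1 A^T uG) => //.
- by rewrite addnC.
- by rewrite subrK.
- by rewrite trmxK.
- by rewrite trmxK.
- by rewrite conj_col_mx F11 F12 F21 F22.
- by rewrite conj_col_mx E11 E12 E21 E22.
by rewrite conj_col_mx Z11 Z12 Z21 Z22 trmxK.
Qed.

(** * The five Jordan algebras *)

(** With a = b, the Jordan product is the associative square. *)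
Lemma rep_sqr (C : numFieldType) (A : jordanAlgebra C) n (g : A -> 'M[C]_n) a :
  symmetric_rep g -> g a *m g a = g (jmul a a).
Proof.
case=> _ _ _ mg _; have := mg a a; rewrite -mulr2n -scaler_nat.
by apply: scalerI; rewrite pnatr_eq0.
Qed.

Lemma rep0 (C : numFieldType) (A : jordanAlgebra C) n (g : A -> 'M[C]_n) :
  symmetric_rep g -> g 0 = 0.
Proof.
by case=> lg _ _ _ _; have := lg (-1) 0 0; rewrite scaler0 addr0 scaleN1r addNr.
Qed.

Lemma repZ (C : numFieldType) (A : jordanAlgebra C) n (g : A -> 'M[C]_n) x a :
  symmetric_rep g -> g (x *: a) = x *: g a.
Proof.
by move=> rg; have [lg _ _ _ _] := rg; rewrite -[x *: a]addr0 lg (rep0 rg) addr0.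
Qed.

Lemma repD (C : numFieldType) (A : jordanAlgebra C) n (g : A -> 'M[C]_n) a b :
  symmetric_rep g -> g (a + b) = g a + g b.
Proof.
by move=> rg; have [lg _ _ _ _] := rg; rewrite -{1}[a]scale1r lg scale1r.
Qed.

Lemma rep_neq0 (C : numFieldType) (A : jordanAlgebra C) n (g : A -> 'M[C]_n) a :
  symmetric_rep g -> a != 0 -> g a != 0.
Proof.
move=> rg; apply: contra_neq => ga; have [_ ig _ _ _] := rg.
by apply: ig; rewrite ga (rep0 rg).
Qed.

Lemma rep_orthogonal (C : numFieldType) (A : jordanAlgebra C) n (g : A -> 'M[C]_n)
    a b :
  symmetric_rep g -> jmul a a = a -> jmul a b = 0 -> g a *m g b = 0.
Proof.
move=> rg aa ab; have [_ _ _ mg _] := rg.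
have ee : g a *m g a = g a by rewrite (rep_sqr _ rg) aa.
have eab : g a *m g b + g b *m g a = 0 by rewrite mg ab (rep0 rg) scaler0.
by have [] := idempotent_anticommute ee eab.
Qed.

(** The order of the three factors is irrelevant to the span, so their ranks may be
sorted. *)
Lemma embedding_C3 (C : numClosedFieldType) n (L : set 'M[C]_n) :
  let CC : jordanAlgebra C := comJordan C^o in
  is_embedding (prodJordan CC (prodJordan CC CC)) L ->
  exists k1 k2 k3 : nat,
    [/\ (1 <= k3)%N, (k1 + 2 * k2 + 3 * k3 = n)%N &
        exists e, congruent e L (A1 k1 k2 k3)].
Proof.
move=> CC /embedding_symmetric_rep[G uG [g rg ->]].
set A := prodJordan _ _ in g rg *.
pose e1 : A := (1, (0, 0)); pose e2 : A := (0, (1, 0)); pose e3 : A := (0, (0, 1)).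
have gen (u : A) : exists x y z : C, u = x *: e1 + y *: e2 + z *: e3.
  case: u => x [y z]; exists x, y, z.
  by congr (_, (_, _)); rewrite /= !scaler0 ?addr0 ?add0r; apply: esym (mulr1 _).
have [lg ig sg mg g1] := rg.
rewrite (rep_image_span3 G lg gen).
have idem (a : A) : jmul a a = a -> g a *m g a = g a.
  by move=> aa; rewrite (rep_sqr _ rg) aa.
have e11 : jmul e1 e1 = e1 by congr (_, (_, _)); rewrite /= ?mulr1 ?mulr0.
have e22 : jmul e2 e2 = e2 by congr (_, (_, _)); rewrite /= ?mulr1 ?mulr0.
have e33 : jmul e3 e3 = e3 by congr (_, (_, _)); rewrite /= ?mulr1 ?mulr0.
have e12 : jmul e1 e2 = 0 by congr (_, (_, _)); rewrite /= ?mulr0 ?mul0r.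
have e13 : jmul e1 e3 = 0 by congr (_, (_, _)); rewrite /= ?mulr0 ?mul0r.
have e23 : jmul e2 e3 = 0 by congr (_, (_, _)); rewrite /= ?mulr0 ?mul0r.
have [r1 [H1 [H11 E1]]] := orthonormal_idempotent (sg e1) (idem _ e11).
have [r2 [H2 [H22 E2]]] := orthonormal_idempotent (sg e2) (idem _ e22).
have [r3 [H3 [H33 E3]]] := orthonormal_idempotent (sg e3) (idem _ e33).
have H12 : H1 *m H2^T = 0.
  by apply: (orthogonal_projections_frames H11 H22); rewrite E1 E2 (rep_orthogonal rg).
have H13 : H1 *m H3^T = 0.
  by apply: (orthogonal_projections_frames H11 H33); rewrite E1 E3 (rep_orthogonal rg).
have H23 : H2 *m H3^T = 0.
  by apply: (orthogonal_projections_frames H22 H33); rewrite E2 E3 (rep_orthogonal rg).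
have H21 := orthogonal_sym H12; have H31 := orthogonal_sym H13.
have H32 := orthogonal_sym H23.
have Hsum : H1^T *m H1 + H2^T *m H2 + H3^T *m H3 = 1%:M.
  rewrite E1 E2 E3 -!(repD _ _ rg) -g1; congr (g _).
  by congr (_, (_, _)); rewrite /= ?(addr0, add0r).
have e1_neq0 : e1 != 0 by rewrite -pair_eqE /= oner_eq0.
have e2_neq0 : e2 != 0 by rewrite -!pair_eqE /= -pair_eqE /= oner_eq0 andbF.
have e3_neq0 : e3 != 0 by rewrite -!pair_eqE /= -pair_eqE /= oner_eq0 !andbF.
have r1_gt0 : (0 < r1)%N by rewrite (@frame_gt0 _ _ _ H1) // E1 (rep_neq0 rg).
have r2_gt0 : (0 < r2)%N by rewrite (@frame_gt0 _ _ _ H2) // E2 (rep_neq0 rg).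
have r3_gt0 : (0 < r3)%N by rewrite (@frame_gt0 _ _ _ H3) // E3 (rep_neq0 rg).
rewrite -E1 -E2 -E3.
move: (leq_total r1 r2) (leq_total r1 r3) (leq_total r2 r3).
have sorted := three_idempotents_congruent uG.
have s213 : H2^T *m H2 + H1^T *m H1 + H3^T *m H3 = 1%:M by rewrite -Hsum (addrC (_ *m H2)).
have s132 : H1^T *m H1 + H3^T *m H3 + H2^T *m H2 = 1%:M by rewrite addrAC.
have s312 : H3^T *m H3 + H1^T *m H1 + H2^T *m H2 = 1%:M by rewrite (addrC (_ *m H3)).
have s231 : H2^T *m H2 + H3^T *m H3 + H1^T *m H1 = 1%:M by rewrite addrAC.
have s321 : H3^T *m H3 + H2^T *m H2 + H1^T *m H1 = 1%:M by rewrite (addrC (_ *m H3)).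
have swap12 := @mxspan3_swap12 C n; have swap23 := @mxspan3_swap23 C n.
case/orP=> h12; case/orP=> h13; case/orP=> h23.
- by rewrite swap12 swap23 swap12; apply: sorted.
- by rewrite swap12 swap23; apply: sorted.
- by rewrite swap12; apply: sorted.
- by rewrite swap12; apply: sorted.
- by rewrite swap23 swap12; apply: sorted.
- by rewrite swap12 swap23; apply: sorted.
- by rewrite swap23; apply: sorted.
by apply: sorted.
Qed.

Lemma jmul0l (C : fieldType) (A : jordanAlgebra C) (b : A) : jmul 0 b = 0.
Proof.
by have := jmul_linear b (-1) 0 0; rewrite scaler0 addr0 scaleN1r addNr.
Qed.

(** The generators are the units of the two factors and a vector d with d^2 = 0. *)
Lemma embedding_CxJ10 (C : numClosedFieldType) n (L : set 'M[C]_n) :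
  is_embedding (prodJordan (comJordan C^o) (spinJordan C 1 0)) L ->
  exists r k1 k2 : nat,
    [/\ (1 <= r)%N, (1 <= k2)%N, (r + (k1 + 2 * k2) = n)%N &
        exists e, congruent e L (A2 r k1 k2)].
Proof.
case/embedding_symmetric_rep=> G uG [g rg ->].
set A := prodJordan _ _ in g rg *.
pose J := spinJordan C 1 0.
pose e1 : A := (1, 0); pose e2 : A := (0, jone J); pose d : A := (0, (0, const_mx 1)).
have gen (u : A) : exists x y z : C, u = x *: e1 + y *: e2 + z *: d.
  case: u => x [y v]; exists x, y, (v 0 0).
  congr (_, (_, _)); rewrite /= ?scaler0 ?addr0 ?add0r.
  - exact: esym (mulr1 _).
  - exact: esym (mulr1 _).
  by apply/rowP => i; rewrite (ord1 i) !mxE mulr1.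
have [lg ig sg mg g1] := rg.
rewrite (rep_image_span3 G lg gen).
have e11 : jmul e1 e1 = e1 by congr (_, _); [apply: mulr1 | apply: jmul0l].
have e1d : jmul e1 d = 0 by congr (_, _); [apply: mulr0 | apply: jmul0l].
have dd : jmul d d = 0.
  congr (_, (_, _)); rewrite /= ?mulr0 ?scale0r ?addr0 //.
  by rewrite /spin_form big1 ?addr0 // => i; rewrite ltn0.
have e1_neq0 : e1 != 0 by rewrite -pair_eqE /= oner_eq0.
have d_neq0 : d != 0.
  rewrite -!pair_eqE /= -pair_eqE /= !eqxx /=; apply/eqP => /rowP/(_ 0).
  by rewrite !mxE => /eqP; rewrite oner_eq0.
have -> : g e2 = 1%:M - g e1.
  apply/eqP; rewrite eq_sym subr_eq addrC -(repD _ _ rg) -g1; apply/eqP.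
  by congr (g _); congr (_, _); rewrite /= ?addr0 ?add0r.
apply: idempotent_square_zero_congruent => //.
- by rewrite (rep_sqr _ rg) e11.
- exact: rep_neq0 rg e1_neq0.
- exact: rep_orthogonal rg e11 e1d.
- by rewrite (rep_sqr _ rg) dd (rep0 rg).
exact: rep_neq0 rg d_neq0.
Qed.

(** The class of X is represented by a matrix N with N^3 = 0, and N^2 is not zero
because the class of X^2 is not. *)
Lemma embedding_truncated_poly (C : numClosedFieldType) n (L : set 'M[C]_n) :
  is_embedding (comJordan (truncated_poly C)) L ->
  exists k1 k2 k3 : nat,
    [/\ (1 <= k3)%N, (k1 + 2 * k2 + 3 * k3 = n)%N &
        exists e, congruent e L (A3 k1 k2 k3)].
Proof.
case/embedding_symmetric_rep=> G uG [g rg ->].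
set A := comJordan _ in g rg *.
pose q (p : {poly C}) : A := in_qpoly 'X^3 p.
have qM p p' : jmul (q p) (q p') = q (p * p').
  by rewrite /q in_qpolyM.
have gen (u : A) : exists x y z : C, u = x *: jone A + y *: q 'X + z *: q 'X^2.
  pose p := val (u : {poly %/ ('X^3 : {poly C})}).
  have sp : (size p <= 3)%N.
    by apply: leq_trans (size_npoly _) _; rewrite mk_monicX3 size_polyXn.
  have uE : u = q p.
    by apply: val_inj; rewrite [RHS]in_qpoly_small //; apply: size_mk_monic.
  exists p`_0, p`_1, p`_2; rewrite {1}uE.
  have -> : jone A = q 1 by rewrite /q in_qpoly1.
  rewrite /q -!in_qpolyZ -!in_qpolyD; congr (in_qpoly _ _).
  apply/polyP => i; rewrite !coefE.
  case: i => [|[|[|i]]] /=; rewrite ?mulr1 ?mulr0 ?addr0 ?add0r //.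
  by rewrite nth_default // (leq_trans sp).
have [lg ig sg mg g1] := rg.
rewrite (rep_image_span3 G lg gen) g1.
have N2 : g (q 'X^2) = g (q 'X) ^+ 2.
  by rewrite [RHS]expr2 -mulmxE (rep_sqr _ rg) qM -expr2.
have q3 : q 'X^3 = 0.
  by apply: val_inj; rewrite /= mk_monicX3 Pdiv.RingMonic.rmodpp ?monicXn.
have q2 : q 'X^2 != 0.
  have E : in_qpoly 'X^3 'X^2 = 'X^2 :> {poly C}.
    by rewrite in_qpoly_small // mk_monicX3 !size_polyXn.
  have : ('X^2 : {poly C}) != 0 by rewrite expf_eq0 polyX_eq0.
  apply: contra_neq => q0; rewrite -E.
  have -> : in_qpoly 'X^3 'X^2 = 0 :> {poly %/ ('X^3 : {poly C})} := q0.
  by rewrite raddf0.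
have N3 : g (q 'X) ^+ 3 = 0.
  have := mg (q 'X) (q 'X^2); rewrite qM -exprS q3 (rep0 rg) scaler0 N2.
  rewrite !mulmxE -exprS -exprSr -mulr2n -scaler_nat => /eqP.
  by rewrite scaler_eq0 pnatr_eq0 => /eqP.
rewrite N2; apply: cube_zero_congruent => //.
by rewrite -N2; apply: rep_neq0 rg q2.
Qed.

(** E represents (1 + v_1)/2 and Z represents v_2, for the standard basis v_1, v_2 of
the vector part.  Since 0 < r, v_1 has square 1 and E is idempotent; v_2 has square
1 or 0 according to whether 1 < r. *)
Lemma spin_embedding_data (C : numClosedFieldType) r n (L : set 'M[C]_n) :
  (0 < r)%N -> is_embedding (spinJordan C 2 r) L ->
  exists2 G : 'M_n, G \in unitmx & exists E Z : 'M_n,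
    [/\ E^T = E /\ E *m E = E, Z^T = Z /\ Z != 0, E *m Z + Z *m E = Z,
        Z *m Z = ((1 < r)%N%:R)%:M &
        L = [set G *m M *m G^T | M in mxspan3 E (1%:M - E) Z]%classic].
Proof.
move=> r_gt0 /embedding_symmetric_rep[G uG [g rg ->]]; exists G => //.
set A := spinJordan C 2 r in g rg *.
pose v1 : 'rV[C]_2 := delta_mx 0 0; pose v2 : 'rV[C]_2 := delta_mx 0 1.
pose e1 : A := (2%:R^-1, 2%:R^-1 *: v1); pose e2 : A := (2%:R^-1, - 2%:R^-1 *: v1).
pose d : A := (0, v2).
have half : 2%:R^-1 + 2%:R^-1 = 1 :> C by field.
have gen (u : A) : exists x y z : C, u = x *: e1 + y *: e2 + z *: d.
  case: u => a v; exists (a + v 0 0), (a - v 0 0), (v 0 1).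
  congr (_, _).
    rewrite /= -![_ *: (_ : C^o)]/(_ * _) /=.
    by rewrite mulr0 addr0 -mulrDl addrACA subrr addr0 mulrDl -mulrDr half mulr1.
  apply/rowP => i; rewrite !mxE.
  case: (ord2_cases i) => ->.
    by rewrite /= !mulr1 !mulr0 addr0; field.
  by rewrite /= !mulr1 !mulr0 !add0r.
have [lg ig sg mg g1] := rg.
have formE (v w : 'rV[C]_2) : spin_form r v w = v 0 0 * w 0 0 + (1 < r)%N%:R * (v 0 1 * w 0 1).
  rewrite /spin_form big_mkcond /= !big_ord_recl big_ord0 /= r_gt0 addr0.
  congr (_ + _); rewrite /bump /=.
  by case: ifP => _; rewrite ?mul1r ?mul0r //; congr (v 0 _ * w 0 _); apply: val_inj.
have e11 : jmul e1 e1 = e1.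
  congr (_, _); rewrite /= ?formE ?mxE /=.
    by rewrite mulr1 !mulr0 addr0 -mulrDl half mul1r.
  by rewrite !scalerA -scalerDl -mulrDl half mul1r.
have dd : jmul d d = (((1 < r)%N%:R) : C) *: jone A.
  congr (_, _); rewrite /= ?formE ?mxE /=.
    by rewrite !mulr0 !add0r !mulr1; apply: esym (mulr1 _).
  by rewrite !scale0r addr0 scaler0.
have e1d : (2%:R : C) *: jmul e1 d = d.
  congr (_, _); rewrite /= ?formE ?mxE /=.
    by rewrite !mulr0 !mul0r mulr0 !addr0 scaler0.
  by rewrite scale0r addr0 scalerA mulfV ?scale1r // pnatr_eq0.
have d_neq0 : d != 0.
  rewrite -pair_eqE /= eqxx /=; apply/eqP => /rowP/(_ 1).
  by rewrite !mxE => /eqP; rewrite oner_eq0.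
exists (g e1), (g d); split.
- by rewrite (rep_sqr _ rg) e11.
- by split=> //; apply: rep_neq0 rg d_neq0.
- by rewrite mg -(repZ _ _ rg) e1d.
- by rewrite (rep_sqr _ rg) dd (repZ _ _ rg) g1 scalemx1.
rewrite (rep_image_span3 G lg gen).
have -> // : g e2 = 1%:M - g e1.
apply/eqP; rewrite eq_sym subr_eq addrC -(repD _ _ rg) -g1; apply/eqP.
congr (g _); congr (_, _); first by rewrite /= half.
by rewrite /= -scalerDl addrN scale0r.
Qed.

Theorem theorem3p3 (R : realType) (n : nat) (n_ge1 : (1 <= n)%N) :
  let C : numClosedFieldType := R[i] in
  let CC : jordanAlgebra C := comJordan C^o in
  [/\ forall L : set 'M[C]_n,
        is_embedding (prodJordan CC (prodJordan CC CC)) L ->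
        exists k1 k2 k3 : nat,
          [/\ (1 <= k3)%N, (k1 + 2 * k2 + 3 * k3 = n)%N &
              exists e, congruent e L (A1 k1 k2 k3)],
      forall L : set 'M[C]_n,
        is_embedding (prodJordan CC (spinJordan C 1 0)) L ->
        exists r k1 k2 : nat,
          [/\ (1 <= r)%N, (1 <= k2)%N, (r + (k1 + 2 * k2) = n)%N &
              exists e, congruent e L (A2 r k1 k2)],
      forall L : set 'M[C]_n,
        is_embedding (comJordan (truncated_poly C)) L ->
        exists k1 k2 k3 : nat,
          [/\ (1 <= k3)%N, (k1 + 2 * k2 + 3 * k3 = n)%N &
              exists e, congruent e L (A3 k1 k2 k3)],
      (odd n -> ~ exists L : set 'M[C]_n, is_embedding (spinJordan C 2 2) L) /\
      (~~ odd n -> forall L : set 'M[C]_n,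
        is_embedding (spinJordan C 2 2) L ->
        exists e, congruent e L (B1 n./2))
    & forall L : set 'M[C]_n,
        is_embedding (spinJordan C 2 1) L ->
        exists k l1 l2 : nat,
          [/\ (2 <= l2)%N, (1 <= k)%N, (2 * k <= l2)%N, (l1 + 2 * l2 = n)%N &
              exists e, congruent e L (B2 k l1 l2)]].
Proof.
move=> C CC; split.
- exact: embedding_C3.
- exact: embedding_CxJ10.
- exact: embedding_truncated_poly.
- have J22 (L : set 'M[C]_n) : is_embedding (spinJordan C 2 2) L ->
      ~~ odd n /\ exists e, congruent e L (B1 n./2).
    case/(@spin_embedding_data _ 2 _ _ isT)=> G uG [E [Z]].
    case=> -[sE EE] [sZ _] EZ ZZ ->.
    exact: spin_nondegenerate_congruent.
  by split=> [on [L /J22[]] | _ L /J22[]]; rewrite ?on.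
move=> L /(@spin_embedding_data _ 1 _ _ isT)[G uG [E [Z]]].
case=> -[sE EE] [sZ Z0] EZ ZZ ->.
by apply: spin_degenerate_congruent => //; rewrite ZZ raddf0.
Qed.
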